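(* Let $k$ be an infinite field, $n\ge1$ an integer, $q=(q_{ij})$ a multiplicatively antisymmetric $n\times n$ matrix over $k^\times$, $R=k_q[[x_1,\ldots,x_n]]$ the $q$-commutative power series ring, and let the torus $H=(k^\times)^n$ act on $R$ by $h.x^s=h_1^{s_1}\cdots h_n^{s_n}x^s$. Let $w$ be a subset of $\{1,\ldots,n\}$ and let $\operatorname{Spec}_wR=\{P\in\operatorname{Spec}R\mid x_i\in P\Leftrightarrow i\in w\}$. Then: (i) $\operatorname{Spec}_wR$ is a union of $H$-orbits of prime ideals in $\operatorname{Spec}R$. (ii) Let $H_w=(k^\times)^{n-|w|}$ act on $L_w$ by rescaling the variables $x_i$, $i\notin w$. Then $L_w$ is $H_w$-simple. (iii) With $H$ acting on $L_w$ and $\operatorname{Spec} L_w$ through the coordinate projection $H\to H_w$ that omits the coordinates indexed by $w$, the homeomorphism $\Theta_w\colon\operatorname{Spec}_wR\to\operatorname{Spec}L_w$, $P\mapsto(P/J_w)L_w$, and its inverse are both $H$-equivariant. In particular $L_w$ is $H$-simple. (iv) Each $H$-orbit of prime ideals in $\operatorname{Spec}_wR$ is dense in $\operatorname{Spec}_wR$.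
   Context: Multiplicatively antisymmetric means $q_{ii}=1$ and $q_{ij}=q_{ji}^{-1}\in k^\times$ for all $i,j$. The ring $R=k_q[[x_1,\ldots,x_n]]$ is the associative unital $k$-algebra of formal skew power series $\sum_{s\in\mathbb{N}^n} c_s x^s$ ($c_s\in k$, $x^s=x_1^{s_1}\cdots x_n^{s_n}$, $\mathbb{N}$ the non-negative integers), with multiplication determined by $x_ix_j=q_{ij}x_jx_i$. It is a noetherian domain and each $x_i$ is normal. The action of $h=(h_1,\ldots,h_n)\in H$ on monomials extends linearly and continuously (coefficientwise) to $k$-algebra automorphisms of $R$, inducing an action on $\operatorname{Spec}R$, the set of prime ideals with the Zariski topology; $\operatorname{Spec}_wR$ has the subspace topology. $J_w=\langle x_i\mid i\in w\rangle$ is the ideal of $R$ generated by the $x_i$ with $i\in w$ (it is completely prime); $R_w=R/J_w$; $X_w$ is the multiplicatively closed subset of $R_w$ generated by $1$ and the images of the $x_i$, $i\notin w$ (normal regular elements); $L_w=R_wX_w^{-1}$ is the Ore localization, which is isomorphic to a $q$-commutative Laurent series ring in the $n-|w|$ variables $x_i$, $i\notin w$ (series with exponents in $\mathbb{Z}$ bounded below). For a group $\Gamma$ acting on a ring by automorphisms, the ring is $\Gamma$-simple if its only $\Gamma$-stable two-sided ideals are zero and the whole ring. *)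

(* Defs.v *)
From HB Require Import structures.
From mathcomp Require Import all_boot all_order all_algebra generic_quotient ring_quotient ring.
From mathcomp Require Import all_classical topology_structure subtype_topology.

Set Implicit Arguments.
Unset Strict Implicit.
Unset Printing Implicit Defensive.

Import GRing.Theory.

Local Open Scope classical_set_scope.
Local Open Scope quotient_scope.
Local Open Scope ring_scope.

Section Ideals.
Variable A : pzRingType.

Definition is_ideal (I : set A) : Prop :=
  [/\ I 0, forall a b, I a -> I b -> I (a + b)
    & forall a b, I b -> I (a * b) /\ I (b * a)].

Record ideal := Ideal { ideal_set :> set A; idealP : is_ideal ideal_set }.

Lemma smallest_is_ideal (E : set A) : is_ideal (smallest is_ideal E).
Proof.
split; first by move=> I [[]].
- by move=> a b Ia Ib I EI; case: (EI) => -[_ ID _] _; apply: ID; [apply: Ia | apply: Ib].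
- move=> a b Ib; split=> I EI; by case: (EI) => -[_ _ /(_ a b (Ib I EI))[]].
Qed.

Definition ideal_gen (E : set A) : ideal := Ideal (smallest_is_ideal E).

(* As P is additive, the premise of the last clause says that the ideal product
   I J is contained in P. *)
Definition is_prime (P : set A) : Prop :=
  [/\ is_ideal P, P != setT
    & forall I J : set A, is_ideal I -> is_ideal J ->
        (forall a b, I a -> J b -> P (a * b)) -> I `<=` P \/ J `<=` P].

Record spec := Spec { spec_set :> set A; specP : is_prime spec_set }.

Lemma spec_inj (P Q : spec) : P = Q :> set A -> P = Q.
Proof.
case: P Q => [P hP] [Q hQ] /= e; rewrite -{}e in hQ *.
by congr Spec; apply: Prop_irrelevance.
Qed.

HB.instance Definition _ := gen_eqMixin spec.
HB.instance Definition _ := gen_choiceMixin spec.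

Definition zariski_open (U : set spec) : Prop :=
  exists2 I : set A, is_ideal I & U = [set P : spec | ~ (I `<=` P)].

Lemma ideal_setT : is_ideal [set: A]. Proof. by []. Qed.

Lemma ideal_setI (I J : set A) : is_ideal I -> is_ideal J -> is_ideal (I `&` J).
Proof.
move=> [I0 ID IM] [J0 JD JM]; split=> //.
- by move=> a b [Ia Ja] [Ib Jb]; split; [apply: ID | apply: JD].
- move=> a b [Ib Jb]; case: (IM a b Ib) (JM a b Jb) => ? ? [? ?].
  by split.
Qed.

Lemma zariski_openT : zariski_open setT.
Proof.
exists setT => //; apply/seteqP; split=> // P _ /= sTP.
by case: (specP P) => _ /eqP + _; apply; apply/seteqP; split.
Qed.

Lemma zariski_openI (U V : set spec) :
  zariski_open U -> zariski_open V -> zariski_open (U `&` V).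
Proof.
move=> [I idI ->] [J idJ ->]; exists (I `&` J); first exact: ideal_setI.
apply/seteqP; split=> P /=; last first.
  by move=> nIJ; split=> sP; apply: nIJ => x [Ix Jx]; apply: sP.
move=> [nI nJ] sIJ; case: (specP P) => _ _ /(_ I J idI idJ) [|//|//] a b Ia Jb.
apply: sIJ; split.
  by case: idI => _ _ /(_ b a Ia) [].
by case: idJ => _ _ /(_ a b Jb) [].
Qed.

Lemma zariski_open_bigU (T : Type) (f : T -> set spec) :
  (forall i, zariski_open (f i)) -> zariski_open (\bigcup_i f i).
Proof.
move=> fo; have /choice[g fg] i : exists I : set A,
    is_ideal I /\ f i = [set P : spec | ~ (I `<=` P)].
  by case: (fo i) => I; exists I.
exists (smallest is_ideal (\bigcup_i g i)); first exact: smallest_is_ideal.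
apply/seteqP; split=> P /=.
  move=> [i _]; rewrite (fg i).2 /= => nP sP; apply: nP => x gx; apply: sP.
  by move=> I [_]; apply; exists i.
move=> nP; apply: contrapT => nU; apply: nP; apply: smallest_sub.
  by case: (specP P).
move=> x [i _ gx]; apply: contrapT => nPx; apply: nU; exists i => //.
by rewrite (fg i).2 /= => /(_ x gx).
Qed.

HB.instance Definition _ := isOpenTopological.Build spec
  zariski_openT zariski_openI zariski_open_bigU.

Record ring_aut := RingAut
  { aut_map :> {rmorphism A -> A}; aut_bij : bijective aut_map }.

Lemma aut_image_prime (s : ring_aut) (P : set A) :
  is_prime P -> is_prime (s @` P).
Proof.
case: s => s [t st ts] /= [[P0 PD PM] PT Pp]; split.
- split; first by exists 0; rewrite ?rmorph0.
  + by move=> _ _ [a Pa <-] [b Pb <-]; exists (a + b); rewrite ?rmorphD //; apply: PD.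
  + move=> a _ [b Pb <-]; rewrite -(ts a) -!rmorphM.
    by split; [exists (t a * b) | exists (b * t a)] => //; case: (PM (t a) b Pb).
- apply/eqP => sPT; case/eqP: PT; apply/seteqP; split=> // x _.
  have [y Py /(congr1 t)] : (s @` P) (s x) by rewrite sPT.
  by rewrite !st => <-.
- move=> I J idI idJ IJ.
  have pre (K : set A) : is_ideal K -> is_ideal (s @^-1` K).
    move=> [K0 KD KM]; split; rewrite /= ?rmorph0 //.
      by move=> a b Ka Kb; rewrite /= rmorphD; apply: KD.
    by move=> a b Kb; rewrite /= !rmorphM; apply: KM.
  case: (Pp _ _ (pre I idI) (pre J idJ)).
  + by move=> a b /= Ia Jb; case: (IJ _ _ Ia Jb) => x Px /(congr1 t);
      rewrite -rmorphM !st => <-.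
  + by move=> sIP; left=> x Ix; exists (t x) => //; apply: sIP; rewrite /= ts.
  + by move=> sIP; right=> x Ix; exists (t x) => //; apply: sIP; rewrite /= ts.
Qed.

Definition spec_act (s : ring_aut) (P : spec) : spec :=
  Spec (aut_image_prime s (specP P)).

Definition Gamma_simple (Gamma : Type) (act : Gamma -> ring_aut) : Prop :=
  forall I : set A, is_ideal I -> (forall g, act g @` I = I) ->
    I = [set 0] \/ I = setT.

Definition spec_orbit (Gamma : Type) (act : Gamma -> ring_aut) (P : spec) : set spec :=
  [set spec_act (act g) P | g in setT].

Definition mul_closed (M : set A) : Prop :=
  M 1 /\ forall a b, M a -> M b -> M (a * b).

Definition mul_gen (E : set A) : set A := smallest mul_closed E.

End Ideals.

(* ring_quotient.v only has quotients of commutative rings. *)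
Section QuotientRing.
Variables (A : pzRingType) (J : ideal A).

Definition ideal_pred : {pred A} := fun a => `[< ideal_set J a >].

Lemma ideal_pred_zmod : zmod_closed ideal_pred.
Proof.
case: (idealP J) => J0 JD JM; split; first exact/asboolP.
move=> a b /asboolP Ja /asboolP Jb; apply/asboolP; apply: JD => //.
by rewrite -mulN1r; case: (JM (-1) b Jb).
Qed.

HB.instance Definition _ := GRing.isZmodClosed.Build A ideal_pred ideal_pred_zmod.

Definition rquot : Type := Quotient.quot ideal_pred.
HB.instance Definition _ := GRing.Zmodule.on rquot.

Definition rquot_pi (a : A) : rquot := \pi_(Quotient.quot ideal_pred) a.

Lemma rquot_piP a b : rquot_pi a = rquot_pi b <-> ideal_set J (a - b).
Proof.
split=> [/eqP|Jab]; last apply/eqP.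
  by rewrite /rquot_pi piE Quotient.equivE => /asboolP.
by rewrite /rquot_pi piE Quotient.equivE; apply/asboolP.
Qed.

Lemma rquot_pi_surj (u : rquot) : exists a, rquot_pi a = u.
Proof. by exists (repr u); rewrite /rquot_pi reprK. Qed.

Definition rquot_repr (u : rquot) : A := repr u.

Lemma rquot_reprK u : rquot_pi (rquot_repr u) = u.
Proof. by rewrite /rquot_pi /rquot_repr reprK. Qed.

Lemma rquot_pi_zmod : zmod_morphism rquot_pi.
Proof. exact: raddfB. Qed.

HB.instance Definition _ := GRing.isZmodMorphism.Build A rquot rquot_pi rquot_pi_zmod.

Definition rquot_one : rquot := rquot_pi 1.
Definition rquot_mul (u v : rquot) : rquot := rquot_pi (rquot_repr u * rquot_repr v).

Lemma rquot_piM a b : rquot_pi (a * b) = rquot_mul (rquot_pi a) (rquot_pi b).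
Proof.
have Jr c : ideal_set J (c - rquot_repr (rquot_pi c)) by apply/rquot_piP; rewrite rquot_reprK.
apply/rquot_piP; set a' := rquot_repr _; set b' := rquot_repr _.
have -> : a * b - a' * b' = (a - a') * b + a' * (b - b').
  by rewrite mulrBl mulrBr addrA subrK.
case: (idealP J) => _ JD JM; apply: JD.
  by case: (JM b (a - a') (Jr a)).
by case: (JM a' (b - b') (Jr b)).
Qed.

Lemma rquot_mulA : associative rquot_mul.
Proof.
by move=> u v t; rewrite -(rquot_reprK u) -(rquot_reprK v) -(rquot_reprK t)
  -!rquot_piM mulrA.
Qed.

Lemma rquot_mul1l : left_id rquot_one rquot_mul.
Proof. by move=> u; rewrite -(rquot_reprK u) -rquot_piM mul1r. Qed.

Lemma rquot_mul1r : right_id rquot_one rquot_mul.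
Proof. by move=> u; rewrite -(rquot_reprK u) -rquot_piM mulr1. Qed.

Lemma rquot_mulDl : left_distributive rquot_mul +%R.
Proof.
by move=> u v t; rewrite -(rquot_reprK u) -(rquot_reprK v) -(rquot_reprK t)
  -raddfD -!rquot_piM -raddfD mulrDl.
Qed.

Lemma rquot_mulDr : right_distributive rquot_mul +%R.
Proof.
by move=> u v t; rewrite -(rquot_reprK u) -(rquot_reprK v) -(rquot_reprK t)
  -raddfD -!rquot_piM -raddfD mulrDr.
Qed.

HB.instance Definition _ := GRing.Zmodule_isPzRing.Build rquot
  rquot_mulA rquot_mul1l rquot_mul1r rquot_mulDl rquot_mulDr.

Lemma rquot_pi_monoid : monoid_morphism rquot_pi.
Proof. by split=> // a b; rewrite rquot_piM. Qed.

HB.instance Definition _ :=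
  GRing.isMonoidMorphism.Build A rquot rquot_pi rquot_pi_monoid.

End QuotientRing.

(* A right ring of fractions L = A X^-1, determined up to unique isomorphism:
   X becomes invertible in L, every element of L is a right fraction
   a x^-1 (that is, y x = a), and the kernel of A -> L is the X-torsion. *)
Record ore_localization (A : pzRingType) (X : set A) := OreLocalization {
  ol_ring :> pzRingType;
  ol_map : {rmorphism A -> ol_ring};
  ol_unit : forall x, X x -> exists v, v * ol_map x = 1 /\ ol_map x * v = 1;
  ol_frac : forall y, exists a x, X x /\ y * ol_map x = ol_map a;
  ol_ker : forall a, ol_map a = 0 -> exists2 x, X x & a * x = 0
}.

(* The right ideal of B generated by the image of S; for a two-sided ideal P
   and a right localization f : A -> B this is the extension P B. *)
Definition right_ext (A B : pzRingType) (f : A -> B) (S : set A) : set B :=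
  [set y | exists m (a : 'I_m -> A) (b : 'I_m -> B),
     (forall i, S (a i)) /\ y = \sum_(i < m) f (a i) * b i].

Section Exponents.
Variable n : nat.

Definition expo := {ffun 'I_n -> nat}.

Implicit Types s t u v : expo.

Definition expo_le t s := [forall i, t i <= s i]%N.
Definition expo_sub s t : expo := [ffun i => s i - t i]%N.

Definition expo_below s : seq expo :=
  [seq t <- [seq ([ffun i => nat_of_ord (r i)] : expo)
            | r : {ffun 'I_n -> 'I_(\max_i s i).+1} <- enum predT] | expo_le t s].

Lemma expo_leP t s : reflect (forall i, t i <= s i)%N (expo_le t s).
Proof. exact: forallP. Qed.

Lemma mem_expo_below s t : (t \in expo_below s) = expo_le t s.
Proof.
rewrite mem_filter andb_idr // => /expo_leP ts; apply/mapP.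
exists [ffun i => inord (t i)]; rewrite ?mem_enum //; apply/ffunP => i; rewrite !ffunE inordK //.
by rewrite ltnS (leq_trans (ts i)) // leq_bigmax.
Qed.

Lemma expo_below_uniq s : uniq (expo_below s).
Proof.
apply: filter_uniq; rewrite map_inj_uniq ?enum_uniq // => r1 r2 /ffunP e.
by apply/ffunP => i; apply: val_inj; have := e i; rewrite !ffunE.
Qed.

Lemma expo_addE s t i : (s + t) i = (s i + t i)%N.
Proof. by rewrite ffunE. Qed.

Lemma expo_addK s t : expo_sub (s + t) s = t.
Proof. by apply/ffunP => i; rewrite ffunE expo_addE addKn. Qed.

Lemma expo_subK s t : expo_le t s -> t + expo_sub s t = s.
Proof. by move=> /expo_leP ts; apply/ffunP => i; rewrite expo_addE ffunE subnKC. Qed.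

Lemma expo_le_addr s t : expo_le s (s + t).
Proof. by apply/expo_leP => i; rewrite expo_addE leq_addr. Qed.

Lemma expo_le_add2l t u v : expo_le (t + u) (t + v) = expo_le u v.
Proof. by apply: eq_forallb => i; rewrite !expo_addE leq_add2l. Qed.

Lemma expo_le_trans u s t : expo_le s u -> expo_le u t -> expo_le s t.
Proof.
by move=> /expo_leP su /expo_leP ut; apply/expo_leP => i; apply: leq_trans (ut i).
Qed.

Lemma big_expo_below2 (V : nmodType) (F : expo -> expo -> expo -> V) s :
  \sum_(v <- expo_below s) \sum_(t <- expo_below v) F t (expo_sub v t) (expo_sub s v) =
  \sum_(t <- expo_below s) \sum_(u <- expo_below (expo_sub s t))
     F t u (expo_sub (expo_sub s t) u).
Proof.
have -> : \sum_(v <- expo_below s) \sum_(t <- expo_below v)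
            F t (expo_sub v t) (expo_sub s v) =
          \sum_(v <- expo_below s) \sum_(t <- expo_below s | expo_le t v)
            F t (expo_sub v t) (expo_sub s v).
  apply: eq_big_seq => v; rewrite mem_expo_below => vs; rewrite -[RHS]big_filter.
  apply: perm_big; apply: uniq_perm; rewrite ?expo_below_uniq ?(filter_uniq _ (expo_below_uniq _)) // => t.
  rewrite mem_expo_below (mem_filter (expo_le^~ v)) mem_expo_below andb_idr // => tv.
  exact: expo_le_trans vs.
rewrite (exchange_big_dep xpredT) //=; apply: eq_big_seq => t.
rewrite mem_expo_below => ts; rewrite -big_filter.
have -> : \sum_(v <- [seq v <- expo_below s | expo_le t v])
            F t (expo_sub v t) (expo_sub s v) =
          \sum_(v <- [seq t + u | u <- expo_below (expo_sub s t)])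
            F t (expo_sub v t) (expo_sub s v).
  apply: perm_big; apply: uniq_perm; rewrite ?expo_below_uniq ?(filter_uniq _ (expo_below_uniq _)) //.
    rewrite map_inj_uniq ?expo_below_uniq // => u v /(congr1 (expo_sub^~ t)).
    by rewrite !expo_addK.
  move=> v; rewrite (mem_filter (expo_le t)) mem_expo_below; apply/andP/mapP => [[tv vs]|[u]].
    exists (expo_sub v t); rewrite ?expo_subK // mem_expo_below.
    by rewrite -(expo_le_add2l t) !expo_subK.
  rewrite mem_expo_below -(expo_le_add2l t) expo_subK // => us ->.
  by rewrite expo_le_addr.
rewrite big_map; apply: eq_bigr => u _; rewrite expo_addK; congr F.
by apply/ffunP => i; rewrite !ffunE subnDA.
Qed.

End Exponents.

(* (k^x)^I *)
Record torus (k : fieldType) (I : Type) := Torus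
  { torus_val :> I -> k; torusP : forall i, torus_val i != 0 }.

(* f s is the coefficient of x_1^(s 1) ... x_n^(s n); q only enters through the
   multiplication. *)
Definition qseries (k : fieldType) (n : nat) (q : 'M[k]_n) : Type := expo n -> k.

Section SkewPowerSeries.
Variables (k : fieldType) (n : nat) (q : 'M[k]_n).

Local Notation R := (qseries q).

Implicit Types (s t u : expo n).

Definition mult_antisym : Prop :=
  (forall i, q i i = 1) /\ (forall i j, q j i != 0 /\ q i j = (q j i)^-1).

(* x^s x^t = qcoef s t x^(s + t): moving the x_j^(t j) to the left past the
   x_i^(s i), j < i, uses  x_i x_j = q_ij x_j x_i. *)
Definition qcoef s t : k := \prod_(i < n) \prod_(j < n | (j < i)%N) q i j ^+ (s i * t j).

Lemma qcoefDl s t u : qcoef (s + t) u = qcoef s u * qcoef t u.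
Proof.
rewrite -big_split; apply: eq_bigr => i _; rewrite -big_split; apply: eq_bigr => j _.
by rewrite expo_addE mulnDl exprD.
Qed.

Lemma qcoefDr s t u : qcoef s (t + u) = qcoef s t * qcoef s u.
Proof.
rewrite -big_split; apply: eq_bigr => i _; rewrite -big_split; apply: eq_bigr => j _.
by rewrite expo_addE mulnDr exprD.
Qed.

Lemma qcoef0l s : qcoef 0 s = 1.
Proof.
by rewrite /qcoef big1 // => i _; rewrite big1 // => j _; rewrite ffunE mul0n.
Qed.

Lemma qcoef0r s : qcoef s 0 = 1.
Proof.
by rewrite /qcoef big1 // => i _; rewrite big1 // => j _; rewrite ffunE muln0.
Qed.

HB.instance Definition _ := GRing.Lmodule.copy R (expo n -> k^o).

Definition qseries_one : R := fun s => (s == 0)%:R.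

Definition qseries_mul (f g : R) : R := fun s =>
  \sum_(t <- expo_below s) qcoef t (expo_sub s t) * f t * g (expo_sub s t).

Lemma qseries_mulA : associative qseries_mul.
Proof.
move=> f g h; apply/funext => s; rewrite /qseries_mul.
have -> : \sum_(v <- expo_below s) qcoef v (expo_sub s v) *
    (\sum_(t <- expo_below v) qcoef t (expo_sub v t) * f t * g (expo_sub v t)) *
    h (expo_sub s v) =
  \sum_(v <- expo_below s) \sum_(t <- expo_below v)
    (qcoef (t + expo_sub v t) (expo_sub s v) * (qcoef t (expo_sub v t) * f t *
    g (expo_sub v t)) * h (expo_sub s v)).
  apply: eq_bigr => v _; rewrite mulr_sumr mulr_suml; apply: eq_big_seq => t.
  by rewrite mem_expo_below => /expo_subK ->.
rewrite (big_expo_below2 (fun t u w => qcoef (t + u) w * (qcoef t u * f t * g u) * h w)).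
apply: eq_big_seq => t; rewrite mem_expo_below => ts.
rewrite mulr_sumr; apply: eq_big_seq => u; rewrite mem_expo_below => us.
rewrite -{1}(expo_subK us) qcoefDl qcoefDr.
set w := expo_sub (expo_sub s t) u; ring.
Qed.

Lemma qseries_mul1l : left_id qseries_one qseries_mul.
Proof.
move=> f; apply/funext => s; rewrite /qseries_mul (bigD1_seq 0) ?expo_below_uniq //=.
  rewrite big1 => [|t /negPf t0]; last by rewrite /qseries_one t0 mulr0 mul0r.
  rewrite addr0 qcoef0l /qseries_one eqxx !mul1r; congr f.
  by apply/ffunP => i; rewrite !ffunE subn0.
by rewrite mem_expo_below; apply/expo_leP => i; rewrite ffunE.
Qed.

Lemma expo_subss s : expo_sub s s = 0.
Proof. by apply/ffunP => i; rewrite !ffunE subnn. Qed.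

Lemma qseries_mul1r : right_id qseries_one qseries_mul.
Proof.
move=> f; apply/funext => s; rewrite /qseries_mul (bigD1_seq s) ?expo_below_uniq //=.
  rewrite big1_seq => [|t /andP[ts]].
    by rewrite addr0 expo_subss qcoef0r /qseries_one eqxx mul1r mulr1.
  rewrite mem_expo_below => /expo_subK tle; rewrite /qseries_one.
  case: eqP => [e|_]; last by rewrite mulr0.
  by rewrite -tle e addr0 eqxx in ts.
by rewrite mem_expo_below; apply/expo_leP.
Qed.

Lemma qseries_mulDl : left_distributive qseries_mul +%R.
Proof.
move=> f g h; apply/funext => s; rewrite /qseries_mul.
by rewrite -[RHS]big_split; apply: eq_bigr => t _; rewrite mulrDr mulrDl.
Qed.

Lemma qseries_mulDr : right_distributive qseries_mul +%R.
Proof.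
move=> f g h; apply/funext => s; rewrite /qseries_mul.
by rewrite -[RHS]big_split; apply: eq_bigr => t _; rewrite mulrDr.
Qed.

Lemma qseries_one_neq0 : qseries_one != 0.
Proof.
by apply/eqP => /(congr1 (fun f : R => f 0)) /eqP;
  rewrite /qseries_one eqxx oner_eq0.
Qed.

HB.instance Definition _ := GRing.Zmodule_isNzRing.Build R
  qseries_mulA qseries_mul1l qseries_mul1r qseries_mulDl qseries_mulDr
  qseries_one_neq0.

Lemma qseries_mulE (f g : R) s :
  (f * g) s = \sum_(t <- expo_below s) qcoef t (expo_sub s t) * f t * g (expo_sub s t).
Proof. by []. Qed.

Lemma qseries_scaleE (a : k) (f : R) s : (a *: f) s = a * f s.
Proof. by []. Qed.

Lemma qseries_scaleAl (a : k) (f g : R) : a *: (f * g) = a *: f * g.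
Proof.
apply/funext => s; rewrite qseries_scaleE !qseries_mulE.
by rewrite mulr_sumr; apply: eq_bigr => t _; rewrite qseries_scaleE; ring.
Qed.

HB.instance Definition _ := GRing.Lmodule_isLalgebra.Build k R qseries_scaleAl.

Lemma qseries_scaleAr (a : k) (f g : R) : a *: (f * g) = f * (a *: g).
Proof.
apply/funext => s; rewrite qseries_scaleE !qseries_mulE.
by rewrite mulr_sumr; apply: eq_bigr => t _; rewrite qseries_scaleE; ring.
Qed.

HB.instance Definition _ := GRing.Lalgebra_isAlgebra.Build k R qseries_scaleAr.

Definition qmon s : R := fun t => (t == s)%:R.

Definition qvar (i : 'I_n) : R := qmon [ffun j => nat_of_bool (j == i)].

Lemma qmonM s t : qmon s * qmon t = qcoef s t *: qmon (s + t).
Proof.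
apply/funext => u; rewrite qseries_mulE qseries_scaleE /qmon.
have [->|us] := eqVneq u (s + t).
  rewrite (bigD1_seq s) ?expo_below_uniq ?mem_expo_below ?expo_le_addr //=.
  rewrite expo_addK !eqxx !mulr1 big1 ?addr0 // => v /negPf ->.
  by rewrite mulr0 mul0r.
rewrite mulr0 big1_seq // => v /andP[_]; rewrite mem_expo_below => /expo_subK vu.
case: eqP => [vs|_]; last by rewrite mulr0 mul0r.
case: eqP => [e|_]; last by rewrite mulr0.
by move: vu us; rewrite e vs => ->; rewrite eqxx.
Qed.

Lemma qvar_comm : mult_antisym -> forall i j, qvar i * qvar j = q i j *: (qvar j * qvar i).
Proof.
have qc i j : qcoef [ffun l => nat_of_bool (l == i)] [ffun l => nat_of_bool (l == j)] =
    if (j < i)%N then q i j else 1.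
  rewrite /qcoef (bigD1 i) //= [X in _ * X]big1 ?mulr1 => [|l /negPf li]; last first.
    by rewrite big1 // => m _; rewrite ffunE li mul0n.
  rewrite big_mkcond (bigD1 j) //= [X in _ * X]big1 ?mulr1 => [|l /negPf lj]; last first.
    by case: ifP => // _; rewrite !ffunE lj muln0.
  by rewrite !ffunE !eqxx.
move=> [qii qV] i j; rewrite !qmonM !qc scalerA (addrC [ffun l => _ (l == j)]).
case: (ltngtP i j) => [ij|ji|/val_inj ->]; rewrite ?qii ?mulr1 //.
have [qji ->] := qV i j; by rewrite mulVf.
Qed.

(* qmon s is the ordered monomial x_1^(s 1) ... x_n^(s n). *)
Lemma qmon_prod s : qmon s = \prod_(i < n) qvar i ^+ s i.
Proof.
pose e i m : expo n := [ffun j => if j == i then m else 0%N].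
have eX (i : 'I_n) m : qvar i ^+ m = qmon (e i m).
  elim: m => [|m IHm].
    rewrite expr0; congr (qmon _); apply/ffunP => j; rewrite !ffunE; by case: eqP.
  rewrite exprS IHm qmonM.
  have -> : [ffun j => nat_of_bool (j == i)] + e i m = e i m.+1.
    by apply/ffunP => j; rewrite expo_addE !ffunE; case: eqP.
  rewrite /qcoef big1 ?scale1r // => a _; rewrite big1 // => b ba; rewrite !ffunE.
  case: (eqVneq a i) => // ai; case: (eqVneq b i) => [bi|_]; rewrite ?muln0 //.
  by rewrite ai bi ltnn in ba.
pose f (r : seq 'I_n) : expo n := [ffun j => if j \in r then s j else 0%N].
have -> : qmon s = qmon (f (enum 'I_n)).
  by congr qmon; apply/ffunP => j; rewrite ffunE mem_enum.
have : sorted (fun i j : 'I_n => i < j)%N (enum 'I_n).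
  by have := iota_ltn_sorted 0 n; rewrite -val_enum_ord sorted_map.
have -> : \prod_(i < n) qvar i ^+ s i = \prod_(i <- enum 'I_n) qvar i ^+ s i.
  by rewrite [index_enum _]unlock -enumT.
elim: (enum 'I_n) => [_|a r IHr].
  by rewrite big_nil; congr qmon; apply/ffunP => j; rewrite !ffunE.
rewrite /= (path_sortedE (fun _ _ _ => @ltn_trans _ _ _)) => /andP[/allP ar r_sorted].
rewrite big_cons -IHr // eX qmonM.
have -> : e a (s a) + f r = f (a :: r).
  apply/ffunP => j; rewrite expo_addE !ffunE inE; case: (eqVneq j a) => //= ->.
  by case: ifP => [/ar|_]; rewrite ?ltnn ?addn0.
rewrite /qcoef big1 ?scale1r // => i _; rewrite big1 // => j ji; rewrite !ffunE.
case: eqP => // ia; case: ifP => [/ar|]; last by rewrite muln0.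
by rewrite -ia ltnNge (ltnW ji).
Qed.

Definition torus_char (h : torus k 'I_n) s : k := \prod_(i < n) h i ^+ s i.

Lemma torus_charD h s t : torus_char h (s + t) = torus_char h s * torus_char h t.
Proof. by rewrite -big_split; apply: eq_bigr => i _; rewrite expo_addE exprD. Qed.

Lemma torus_char0 h : torus_char h 0 = 1.
Proof. by rewrite /torus_char big1 // => i _; rewrite ffunE. Qed.

Lemma torus_char_neq0 h s : torus_char h s != 0.
Proof. by apply/prodf_neq0 => i _; rewrite expf_neq0 ?torusP. Qed.

Definition qseries_rescale (h : torus k 'I_n) (f : R) : R :=
  fun s => torus_char h s * f s.

Lemma qseries_rescale_zmod h : zmod_morphism (qseries_rescale h).
Proof. by move=> f g; apply/funext => s; apply: mulrBr. Qed.

HB.instance Definition _ h :=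
  GRing.isZmodMorphism.Build R R (qseries_rescale h) (qseries_rescale_zmod h).

Lemma qseries_rescale_monoid h : monoid_morphism (qseries_rescale h).
Proof.
split=> [|f g]; apply/funext => s.
  rewrite /qseries_rescale /GRing.one /= /qseries_one; case: eqP => [->|_].
    by rewrite torus_char0 mulr1.
  by rewrite mulr0.
rewrite /qseries_rescale !qseries_mulE mulr_sumr; apply: eq_big_seq => t.
rewrite mem_expo_below => /expo_subK {1}<-; rewrite torus_charD; ring.
Qed.

HB.instance Definition _ h :=
  GRing.isMonoidMorphism.Build R R (qseries_rescale h) (qseries_rescale_monoid h).

Lemma qseries_rescale_bij h : bijective (qseries_rescale h).
Proof.
exists (fun f s => (torus_char h s)^-1 * f s) => f; apply/funext => s.
  by rewrite /qseries_rescale mulKf ?torus_char_neq0.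
by rewrite /qseries_rescale mulVKf ?torus_char_neq0.
Qed.

Definition torus_act (h : torus k 'I_n) : ring_aut R :=
  RingAut (qseries_rescale_bij h).

Variable w : {set 'I_n}.

Definition Spec_w : set (spec R) :=
  [set P | forall i, (P : set _) (qvar i) <-> i \in w].

Definition J_w : ideal R := ideal_gen [set qvar i | i in [set` w]].

Definition R_w : pzRingType := rquot J_w.

Definition X_w : set R_w := mul_gen [set rquot_pi J_w (qvar i) | i in ~` [set` w]].

(* The torus H_w, its coordinates being labelled by the complement of w. *)
Definition torus_w : Type := torus k {i : 'I_n | i \notin w}.

Definition torus_proj (h : torus k 'I_n) : torus_w :=
  Torus (fun j : {i : 'I_n | i \notin w} => torusP h (val j)).

Definition torus_ext_fun (g : torus_w) (i : 'I_n) : k :=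
  if insub i is Some j then g j else 1.

Lemma torus_ext_fun_neq0 g i : torus_ext_fun g i != 0.
Proof. by rewrite /torus_ext_fun; case: insub => [j|]; rewrite ?torusP ?oner_neq0. Qed.

Definition torus_ext (g : torus_w) : torus k 'I_n := Torus (torus_ext_fun_neq0 g).

(* The automorphisms  act g  of L_w rescale the variables x_i, i \notin w: on the
   image of R_w they act coefficientwise, which determines them on L_w. *)
Definition rescaling_action (L : ore_localization X_w) (act : torus_w -> ring_aut L)
    : Prop :=
  forall (g : torus_w) (f : R),
    act g (ol_map L (rquot_pi J_w f)) =
    ol_map L (rquot_pi J_w (torus_act (torus_ext g) f)).

End SkewPowerSeries.

Arguments qvar {k n} q i.
Arguments torus_act {k n} q h.
Arguments Spec_w {k n} q w.
Arguments J_w {k n} q w.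
Arguments R_w {k n} q w.
Arguments X_w {k n} q w.
Arguments torus_w k {n} w.
Arguments torus_proj {k n} w h.

(* Main.v *)
Require Import Defs.
From mathcomp Require Import all_boot all_order all_algebra.
From mathcomp Require Import all_classical topology_structure subtype_topology.

(* R is left noetherian: a division algorithm along the lexicographic order on
   exponents reduces any series modulo a left ideal I to one supported outside
   the set S of leading exponents of I, using finitely many elements of I
   (Dickson's lemma).  If I is stable under the torus and s lies in S, the
   reduced element x^s - r of I must be an eigenvector of the torus, since
   otherwise a combination with a translate would be a nonzero element of I
   supported outside S; as k is infinite, distinct exponents give distinct
   characters, so r = 0 and x^s lies in I.  Hence a stable ideal strictly
   containing J_w contains a monomial in the x_i, i \notin w, which is invertible
   in L_w and lies in no prime of Spec_w R: this gives simplicity of L_w, and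
   density when applied to the intersection of an orbit.  The bijection of spectra
   is the correspondence for localization at normal elements, where contracting
   primes of L_w requires noetherianity. *)

Set Implicit Arguments.
Unset Strict Implicit.
Unset Printing Implicit Defensive.

Import GRing.Theory.

Local Open Scope classical_set_scope.
Local Open Scope ring_scope.

(** * Left ideals, the noetherian condition, and normal elements modulo a prime *)

Section LeftIdeals.
Variable A : pzRingType.

Definition is_left_ideal (I : set A) : Prop :=
  [/\ I 0, forall a b, I a -> I b -> I (a + b) & forall a b, I b -> I (a * b)].

Definition left_noetherian : Prop :=
  forall I : set A, is_left_ideal I ->
    exists m (g : 'I_m -> A), (forall j, I (g j)) /\
      forall f, I f -> exists c : 'I_m -> A, f = \sum_j c j * g j.

Lemma ideal_left (I : set A) : is_ideal I -> is_left_ideal I.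
Proof. by move=> [I0 ID IM]; split=> // a b /(IM a)[]. Qed.

Lemma ideal_mull (I : set A) a b : is_ideal I -> I b -> I (a * b).
Proof. by move=> [_ _ IM] /(IM a)[]. Qed.

Lemma ideal_mulr (I : set A) a b : is_ideal I -> I a -> I (a * b).
Proof. by move=> [_ _ IM] /(IM b)[]. Qed.

Lemma left_ideal_sum (I : set A) (m : nat) (F : 'I_m -> A) :
  is_left_ideal I -> (forall j, I (F j)) -> I (\sum_j F j).
Proof. by move=> [I0 ID _] IF; apply: (big_ind I). Qed.

Lemma left_idealB (I : set A) a b : is_left_ideal I -> I a -> I b -> I (a - b).
Proof. by move=> [_ ID IM] Ia Ib; apply: ID => //; rewrite -mulN1r; apply: IM. Qed.

Lemma noetherian_chain (E : nat -> set A) : left_noetherian ->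
  (forall i, is_left_ideal (E i)) -> (forall i, E i `<=` E i.+1) ->
  exists N, forall i, E i `<=` E N.
Proof.
move=> noeA idE Ele.
have le i j : (i <= j)%N -> E i `<=` E j.
  move=> /subnK <-; elim: (j - i)%N => [|p IH] //.
  by apply: subset_trans IH _; rewrite addSn; apply: Ele.
have [|m [g [Eg gen]]] := noeA (\bigcup_i E i).
  split; first by exists 0%N => //; case: (idE 0%N).
    move=> a b [i _ Ea] [j _ Eb]; exists (maxn i j) => //.
    by case: (idE (maxn i j)) => _ ED _; apply: ED;
      [apply: le Ea; apply: leq_maxl | apply: le Eb; apply: leq_maxr].
  by move=> a b [i _ Eb]; exists i => //; case: (idE i) => _ _; apply.
have /choice[f fE] j : exists i, E i (g j) by case: (Eg j) => i; exists i.
exists (\max_j f j) => i a Ea; have [|c ->] := gen a; first by exists i.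
apply: left_ideal_sum => // j; case: (idE (\max_j f j)) => _ _; apply.
by apply: le (fE j); apply: leq_bigmax.
Qed.

(** The preimages of I under the iterates of s form an ascending chain, stationary from some N on.
    If s a lies in I, then s^-N a lies in the preimage of index N+1, hence in that of index N, so a
    lies in I. *)
Lemma noetherian_aut (s : ring_aut A) (I : set A) : left_noetherian ->
  is_left_ideal I -> (forall a, I a -> I (s a)) -> forall a, I (s a) -> I a.
Proof.
move=> noeA [I0 ID IM] sI.
have [|i|N EN] := @noetherian_chain (fun i => [set a | I (iter i s a)]) noeA.
- move=> i; have iterD a b : iter i s (a + b) = iter i s a + iter i s b.
    by elim: i => //= i ->; rewrite rmorphD.
  have iterM a b : iter i s (a * b) = iter i s a * iter i s b.
    by elim: i {iterD} => //= i ->; rewrite rmorphM.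
  have iter0 : iter i s 0 = 0 by elim: i {iterD iterM} => //= i ->; rewrite rmorph0.
  split=> /=; rewrite ?iter0 // => a b; first by rewrite iterD; apply: ID.
  by rewrite iterM; apply: IM.
- by move=> a /=; apply: sI.
case: (aut_bij s) => t st ts.
have tK j a : iter j s (iter j t a) = a.
  by elim: j a => //= j IH a; rewrite -iterS iterSr ts.
move=> a Isa; have := EN N.+1 (iter N t a); rewrite /= tK; exact.
Qed.

(** The conjugating automorphism is part of the notion, so that [noetherian_aut] can be applied to
    it; d need not be regular. *)
Definition normal_elt (d : A) : Prop := exists s : ring_aut A, forall a, a * d = d * s a.

Lemma normal_eltV d : normal_elt d -> forall a, exists a', d * a = a' * d.
Proof.
move=> [s sd] a; case: (aut_bij s) => t st ts.
by exists (t a); rewrite sd ts.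
Qed.

(** By normality both A d and the set of a with d a in P are two-sided ideals. Their product lies in
    P, and A d does not. *)
Lemma prime_normal_mull (P : set A) d : is_prime P -> normal_elt d ->
  ~ P d -> forall a, P (d * a) -> P a.
Proof.
move=> [idP _ prP] nd nPd; have [P0 PD PM] := idP.
have dV := normal_eltV nd; case: nd => s sd.
case: (prP [set r * d | r in setT] [set a | P (d * a)]).
- split; first by exists 0; rewrite ?mul0r.
    by move=> _ _ [a _ <-] [b _ <-]; exists (a + b); rewrite ?mulrDl.
  move=> a _ [b _ <-]; split; first by exists (a * b); rewrite ?mulrA.
  by rewrite -mulrA; have [a' ->] := dV a; exists (b * a'); rewrite ?mulrA.
- split; rewrite /= ?mulr0 //.
    by move=> a b Pa Pb; rewrite mulrDr; apply: PD.
  move=> a b Pb; split; last by rewrite mulrA; apply: ideal_mulr.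
  by have [a' e] := dV a; rewrite mulrA e -mulrA; apply: ideal_mull.
- by move=> _ b [r _ <-] /= Pb; rewrite -mulrA; apply: ideal_mull.
- by move=> sP; case: nPd; apply: sP; exists 1; rewrite ?mul1r.
- by [].
Qed.

Lemma prime_normal_mulr (P : set A) d : is_prime P -> normal_elt d ->
  ~ P d -> forall a, P (a * d) -> P a.
Proof.
move=> [idP _ prP] nd nPd; have [P0 PD PM] := idP.
have dV := normal_eltV nd; case: nd => s sd.
case: (prP [set a | P (a * d)] [set d * r | r in setT]).
- split; rewrite /= ?mul0r //.
    by move=> a b Pa Pb; rewrite mulrDl; apply: PD.
  move=> a b Pb; split; first by rewrite -mulrA; apply: ideal_mull.
  by rewrite -mulrA sd mulrA; apply: ideal_mulr.
- split; first by exists 0; rewrite ?mulr0.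
    by move=> _ _ [a _ <-] [b _ <-]; exists (a + b); rewrite ?mulrDr.
  move=> a _ [b _ <-]; split; last by exists (b * a); rewrite ?mulrA.
  by rewrite mulrA sd; exists (s a * b); rewrite ?mulrA.
- by move=> a _ /= Pa [r _ <-]; rewrite mulrA; apply: ideal_mulr.
- by [].
- by move=> sP; case: nPd; apply: sP; exists 1; rewrite ?mulr1.
Qed.

End LeftIdeals.

(** * Extension and contraction of primes for localization at normal elements *)

Section NormalLocalization.
Variables (A B : pzRingType) (phi : {rmorphism A -> B}) (D : set A).
Hypothesis D_closed : mul_closed D.
Hypothesis D_normal : forall d, D d -> normal_elt d.
Hypothesis D_unit : forall d, D d -> exists v, v * phi d = 1 /\ phi d * v = 1.
Hypothesis D_frac : forall y, exists a d, D d /\ y * phi d = phi a.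

(** The extension P B as a set of single fractions a d^-1; [right_ext_loc] compares it with finite
    sums. *)
Definition loc_ext (P : set A) : set B :=
  [set y | exists a d, [/\ P a, D d & y * phi d = phi a]].

Lemma unit_cancell (I : set B) d y : is_ideal I -> D d -> I (phi d * y) -> I y.
Proof.
by move=> idI /D_unit[v [vd _]] Iy; rewrite -(mul1r y) -vd -mulrA; apply: ideal_mull.
Qed.

Lemma unit_cancelr (I : set B) d y : is_ideal I -> D d -> I (y * phi d) -> I y.
Proof.
by move=> idI /D_unit[v [_ dv]] Iy; rewrite -(mulr1 y) -dv mulrA; apply: ideal_mulr.
Qed.

Lemma preimage_ideal (I : set B) : is_ideal I -> is_ideal (phi @^-1` I).
Proof.
move=> [I0 ID IM]; split; rewrite /= ?rmorph0 //.
  by move=> a b Ia Ib; rewrite rmorphD; apply: ID.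
by move=> a b Ib; rewrite !rmorphM; apply: IM.
Qed.

(** Denominators pass numerators through the conjugating automorphisms. In z y this turns the
    numerator a of y into s a, where a e = e (s a); left cancellation of e modulo P keeps s a in
    P. *)
Lemma loc_ext_ideal (P : set A) : is_ideal P ->
  (forall d a, D d -> P (d * a) -> P a) -> is_ideal (loc_ext P).
Proof.
move=> idP satP; have [P0 PD PM] := idP; have [D1 DM] := D_closed.
split.
- by exists 0, 1; rewrite mul0r rmorph0.
- move=> y z [a [d [Pa Dd ya]]] [b [e [Pb De zb]]].
  have [s es] := D_normal De.
  (* As d e = e (s d), the product d e is a common denominator of y and z. *)
  exists (a * e + b * s d), (d * e); split; last 1 first.
  + by rewrite mulrDl rmorphD !rmorphM mulrA ya -[in z * _]rmorphM es rmorphM mulrA zb.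
  + by apply: PD; apply: ideal_mulr.
  + exact: DM.
- move=> z y [a [d [Pa Dd ya]]]; have [b [e [De zb]]] := D_frac z.
  have [s es] := D_normal De; have [t dt] := D_normal Dd; split.
    exists (b * s a), (d * e); split; first 1 last.
    + exact: DM.
    + rewrite rmorphM mulrA -(mulrA z) ya -mulrA -rmorphM es rmorphM mulrA zb.
      by rewrite rmorphM.
    + by apply: ideal_mull => //; apply: (satP e) => //; rewrite -es; apply: ideal_mulr.
  exists (a * t b), (e * d); split; first exact: ideal_mulr.
  + exact: DM.
  + rewrite rmorphM mulrA -(mulrA y) zb -mulrA -rmorphM dt rmorphM mulrA ya.
    by rewrite rmorphM.
Qed.

Lemma loc_ext_sub (P : set A) (I : set B) :
  phi @^-1` I `<=` P -> is_ideal I -> I `<=` loc_ext P.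
Proof.
move=> IP idI y Iy; have [a [d [Dd ya]]] := D_frac y.
by exists a, d; split=> //; apply: IP; rewrite /= -ya; apply: ideal_mulr.
Qed.

Lemma loc_ext_preimage (I : set B) : is_ideal I -> loc_ext (phi @^-1` I) = I.
Proof.
move=> idI; apply/seteqP; split; last exact: loc_ext_sub.
by move=> y [a [d [Ia Dd ya]]]; apply: (unit_cancelr idI Dd); rewrite ya.
Qed.

Lemma preimage_loc_ext (P : set A) : is_ideal P ->
  phi @^-1` [set 0] `<=` P -> (forall d a, D d -> P (a * d) -> P a) ->
  phi @^-1` (loc_ext P) = P.
Proof.
move=> idP kerP satP; have [_ PD _] := idP; apply/seteqP; split=> a; last first.
  by case: D_closed => D1 _ Pa; exists a, 1; rewrite rmorph1 mulr1.
move=> [b [d [Pb Dd e]]]; apply: (satP d) => //; rewrite -(subrK b (a * d)).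
by apply: PD => //; apply: kerP; rewrite /= rmorphB rmorphM e subrr.
Qed.

Lemma loc_ext_prime (P : set A) : is_prime P ->
  phi @^-1` [set 0] `<=` P -> (forall d, D d -> ~ P d) ->
  is_prime (loc_ext P).
Proof.
move=> prP kerP DP; have [idP PT PIJ] := prP.
have preE : phi @^-1` (loc_ext P) = P.
  apply: preimage_loc_ext => // d a Dd.
  by apply: prime_normal_mulr => //; [apply: D_normal | apply: DP].
split.
- apply: loc_ext_ideal => // d a Dd.
  by apply: prime_normal_mull => //; [apply: D_normal | apply: DP].
- by apply/eqP => eT; case/eqP: PT; rewrite -preE eT preimage_setT.
- move=> I J idI idJ IJ.
  have [a b Ia Jb|sIP|sJP] := PIJ _ _ (preimage_ideal idI) (preimage_ideal idJ).
  + by rewrite -preE /= rmorphM; apply: IJ.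
  + by left; apply: loc_ext_sub.
  + by right; apply: loc_ext_sub.
Qed.

(* Only half of the invariance of the annihilator I under conjugation by D is
   formal; the chain condition supplies the other half. *)
Lemma preimage_prime (Q : set B) : left_noetherian A -> is_prime Q ->
  is_prime (phi @^-1` Q).
Proof.
move=> noeA [idQ QT QIJ]; have idP := preimage_ideal idQ; split=> //.
  apply/eqP => PT; case/eqP: QT; apply/seteqP; split=> // y _.
  have : (phi @^-1` Q) 1 by rewrite PT.
  by rewrite /= rmorph1 => Q1; rewrite -(mulr1 y); apply: (ideal_mull _ idQ).
(* I0 is enlarged to the full annihilator of J0 modulo the contraction, which allows left
   cancellation of D and so extends to an ideal of B. *)
move=> I0 J0 idI0 idJ0 IJ0; pose I := [set a | forall b, J0 b -> Q (phi (a * b))].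
have idI : is_ideal I.
  have [Q0 QD QM] := idQ; split=> [b _|a a' Ia Ia' b Jb|a a' Ia'].
  - by rewrite mul0r rmorph0.
  - by rewrite mulrDl rmorphD; apply: QD; [apply: Ia|apply: Ia'].
  - split=> b Jb; last by rewrite -mulrA; apply: Ia'; apply: ideal_mull.
    by rewrite -mulrA rmorphM; apply: ideal_mull => //; apply: Ia'.
have satI d a : D d -> I (d * a) -> I a.
  move=> Dd Ida b Jb; apply: (unit_cancell idQ Dd).
  by rewrite -rmorphM mulrA; apply: Ida.
have idE := loc_ext_ideal idI satI.
have [||EQ|JQ] := QIJ _ [set y | forall z, loc_ext I z -> Q (z * y)] idE.
- have [Q0 QD QM] := idQ; split=> [z _|y y' Hy Hy' z Ez|y y' Hy].
  + by rewrite mulr0.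
  + by rewrite mulrDr; apply: QD; [apply: Hy|apply: Hy'].
  + split=> z Ez; last by rewrite mulrA; apply: ideal_mulr => //; apply: Hy.
    by rewrite mulrA; apply: Hy; apply: (ideal_mulr _ idE).
- by move=> z y Ez /(_ z Ez).
- left=> a I0a; apply: EQ; case: D_closed => D1 _.
  by exists a, 1; split; rewrite ?rmorph1 ?mulr1 // => b Jb; apply: IJ0.
- right=> b Jb; apply: JQ => z [a [d [Ia Dd za]]].
  have [s ds] := D_normal Dd; have [t st ts] := aut_bij s.
  (* Moving the denominator to the left gives z = d^-1 (t a), so t a must lie in I. Stability of I
     under s follows from [satI]; the chain condition yields it for the inverse t. *)
  have It : I (t a).
    apply: (noetherian_aut noeA (ideal_left idI) (s := s)); last by rewrite ts.
    by move=> c Ic; apply: (satI d) => //; rewrite -ds; apply: (ideal_mulr _ idI).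
  have tE : phi (t a) = phi d * z.
    have [v [_ dv]] := D_unit Dd.
    rewrite -[LHS]mulr1 -[RHS]mulr1 -dv !mulrA; congr (_ * v).
    by rewrite -mulrA za -!rmorphM ds ts.
  by apply: (unit_cancell idQ Dd); rewrite mulrA -tE -rmorphM; apply: It.
Qed.

End NormalLocalization.

(** * The lexicographic well-order on exponents, and Dickson's lemma *)

Section LexicographicOrder.
Variable n : nat.
Implicit Types (s t u v : expo n) (S : set (expo n)).

Definition expo_lex s t : Prop :=
  exists i, (s i < t i)%N /\ forall j : 'I_n, (j < i)%N -> s j = t j.

Lemma expo_lex_asym s t : expo_lex s t -> ~ expo_lex t s.
Proof.
move=> [i [si ei]] [j [sj ej]]; case: (ltngtP i j) => [ij|ji|/val_inj ij].
- by move: si; rewrite (ej i ij) ltnn.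
- by move: sj; rewrite (ei j ji) ltnn.
- by move: sj; rewrite -ij ltnNge (ltnW si).
Qed.

Lemma expo_lexDl u s t : expo_lex s t -> expo_lex (u + s) (u + t).
Proof.
move=> [i [si ei]]; exists i; split; first by rewrite !expo_addE ltn_add2l.
by move=> j ji; rewrite !expo_addE ei.
Qed.

Lemma expo_lex_min S : S !=set0 ->
  exists2 m, S m & forall s, S s -> s != m -> expo_lex m s.
Proof.
move=> [s0 Ss0].
(* Induction on p: m is minimal on the first p coordinates, and the next coordinate is minimized
   among the members of S agreeing with m so far. *)
suff H p : (p <= n)%N -> exists2 m, S m & forall s, S s ->
    (forall j : 'I_n, (j < p)%N -> s j = m j) \/ expo_lex m s.
  have [m Sm mP] := H n (leqnn n); exists m => // s Ss /eqP sm.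
  by case: (mP s Ss) => // e; case: sm; apply/ffunP => j; apply: e.
elim: p => [|p IH] pn; first by exists s0 => // s _; left.
have [m Sm mP] := IH (ltnW pn); pose i := Ordinal pn.
pose T c := `[< exists s, [/\ S s, forall j : 'I_n, (j < p)%N -> s j = m j & s i = c] >].
have exT : exists c, T c by exists (m i); apply/asboolP; exists m.
case: (ex_minnP exT) => c /asboolP[m' [Sm' m'm m'i]] c_min; exists m' => // s Ss.
have [sm|nsm] := pselect (forall j : 'I_n, (j < p)%N -> s j = m j); last first.
  have [j [jp mj ej]] : exists j : 'I_n, [/\ (j < p)%N, (m j < s j)%N &
      forall l : 'I_n, (l < j)%N -> m l = s l].
    case: (mP s Ss) => // -[j [mj ej]]; exists j; split=> //.
    rewrite ltnNge; apply/negP => pj; apply: nsm => l lp.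
    by rewrite ej // (leq_trans lp).
  by right; exists j; split=> [|l lj]; rewrite m'm // ?ej // (ltn_trans lj).
have : (c <= s i)%N by apply: c_min; apply/asboolP; exists s.
rewrite leq_eqVlt => /orP[/eqP ci|ci].
  left=> j; rewrite ltnS leq_eqVlt => /orP[/eqP jp|jp]; last by rewrite m'm ?sm.
  by have -> : j = i by [apply: val_inj]; rewrite m'i.
by right; exists i; rewrite m'i; split=> // j jp; rewrite m'm ?sm.
Qed.

Lemma expo_lex_wf : well_founded expo_lex.
Proof.
move=> s; apply: contrapT => nAs.
have [|m nAm mP] := @expo_lex_min [set s | ~ Acc expo_lex s]; first by exists s.
apply: nAm; constructor=> t tm; apply: contrapT => nAt.
have [e|tm'] := eqVneq t m; first by rewrite e in tm; apply: (expo_lex_asym tm tm).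
exact: expo_lex_asym tm (mP t nAt tm').
Qed.

(** An exponent may have infinitely many predecessors, so the recursion is well-founded rather than
    over a natural number. The hypothesis says that F s b depends on b only below s; x is a dummy
    value elsewhere. *)
Lemma expo_lex_rec (T : Type) (x : T) (F : expo n -> (expo n -> T) -> T) :
  (forall s b c, (forall t, expo_lex t s -> b t = c t) -> F s b = F s c) ->
  exists b, forall s, b s = F s b.
Proof.
move=> FE.
pose G s (b : forall t, expo_lex t s -> T) : T :=
  F s (fun t => if pselect (expo_lex t s) is left ts then b t ts else x).
exists (Fix expo_lex_wf (fun=> T) G) => s; rewrite Fix_eq; last first.
  move=> u b c bc; apply: FE => t tu.
  by case: (pselect _) => // ts; apply: bc.
by apply: FE => t ts; case: (pselect _).
Qed.

(* Dickson's lemma, coordinate by coordinate. *)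
Lemma expo_finite_basis S : exists T : seq (expo n),
  (forall t, t \in T -> S t) /\
  forall s, S s -> exists2 t, t \in T & expo_le t s.
Proof.
suff H (r : seq 'I_n) (S' : set (expo n)) : exists T : seq (expo n),
    (forall t, t \in T -> S' t) /\
    forall s, S' s -> exists2 t, t \in T & forall i, i \in r -> (t i <= s i)%N.
  have [T [TS TP]] := H (enum 'I_n) S; exists T; split=> // s /TP[t Tt ts].
  by exists t => //; apply/expo_leP => i; apply: ts; rewrite mem_enum.
elim: r S' => [|i r IH] S'.
  have [[s Ss]|nS] := pselect (S' !=set0); last first.
    by exists [::]; split=> // s Ss; case: nS; exists s.
  exists [:: s]; split=> [t|t _]; first by rewrite inE => /eqP ->.
  by exists s; rewrite ?inE.
have [T0 [T0S T0P]] := IH S'.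
have /choice[f fP] c := IH [set s | S' s /\ s i = c].
(* If s i >= N, coordinate i imposes nothing beyond T0; each of the finitely many slices s i = c
   with c < N gets its own basis. *)
pose N := \max_(t <- T0) t i.
exists (T0 ++ flatten [seq f c | c <- iota 0 N]); split=> [t|s Ss].
  rewrite mem_cat => /orP[/T0S //|/flatten_mapP[c _]].
  by case: (fP c) => fS _ /fS[].
have [Ns|sN] := leqP N (s i).
  have [t Tt ts] := T0P s Ss; exists t; first by rewrite mem_cat Tt.
  move=> j; rewrite inE => /orP[/eqP ->|/ts //]; apply: leq_trans Ns.
  by rewrite /N (big_rem t) //= leq_maxl.
have [fS /(_ s) []// t Tt ts] := fP (s i).
exists t.
  by rewrite mem_cat; apply/orP; right; apply/flatten_mapP; exists (s i); rewrite ?mem_iota.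
by move=> j; rewrite inE => /orP[/eqP ->|/ts //]; case: (fS t Tt) => _ ->.
Qed.

End LexicographicOrder.

(** * Division of skew power series by a set of leading exponents, and noetherianity *)

Section Division.
Variables (k : fieldType) (n : nat) (q : 'M[k]_n).
Hypothesis q_antisym : mult_antisym q.
Local Notation R := (qseries q).
Implicit Types (s t u : expo n) (f g : R) (I : set R).

Lemma qcoef_neq0 s t : qcoef q s t != 0.
Proof.
apply/prodf_neq0 => i _; apply/prodf_neq0 => j _.
by rewrite expf_neq0 //; case: (q_antisym.2 j i).
Qed.

(** Leading means smallest, since the support of a power series may have no largest element. *)
Definition is_lead f s : Prop :=
  f s != 0 /\ forall t, f t != 0 -> t != s -> expo_lex s t.

Definition lead_set I : set (expo n) := [set s | exists2 f, I f & is_lead f s].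

Lemma is_lead_exists f : f != 0 -> exists s, is_lead f s.
Proof.
move=> f0; have [|s fs sP] := @expo_lex_min n [set s | f s != 0].
  apply: contrapT => nf; case/eqP: f0; apply/funext => s; apply: contrapT => /eqP fs.
  by apply: nf; exists s.
by exists s.
Qed.

(* The equations at the exponents above some leading exponent are solved for
   the coefficients of the quotients by recursion along expo_lex. *)
Lemma qseries_division I : exists m (g : 'I_m -> R), (forall j, I (g j)) /\
  forall f, exists c : 'I_m -> R,
    forall s, lead_set I s -> (f - \sum_j c j * g j) s = 0.
Proof.
have [T [TI TP]] := expo_finite_basis (lead_set I).
pose t_ (j : 'I_(size T)) := tnth (in_tuple T) j.
have /choice[g gP] j : exists g, I g /\ is_lead g (t_ j).
  by have [g Ig gt] := TI _ (mem_tnth j (in_tuple T)); exists g.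
exists (size T), g; split=> [j|f]; first by case: (gP j).
pose idx s := [pick j | expo_le (t_ j) s].
(* One family b holds the coefficients of all quotients: b s is the coefficient at s - t_j of the
   quotient j that [idx] selects for s. *)
pose quo (b : expo n -> k) j : R := fun u =>
  if idx (u + t_ j) == Some j then b (u + t_ j) else 0.
(* The contribution of the non-leading terms of the g j to the coefficient at s; its nonzero terms
   involve b only at exponents u + t_j below s. *)
pose tail (b : expo n -> k) s := \sum_j \sum_(u <- expo_below s | expo_sub s u != t_ j)
  qcoef q u (expo_sub s u) * quo b j u * g j (expo_sub s u).
pose F s b := if idx s is Some j then
  (f s - tail b s) / (qcoef q (expo_sub s (t_ j)) (t_ j) * g j (t_ j)) else 0.
have [s b c bc|b bE] := expo_lex_rec 0 (F := F).
  rewrite /F; case: (idx s) => // j; congr ((_ - _) / _).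
  apply: eq_bigr => l _; rewrite big_seq_cond [RHS]big_seq_cond.
  apply: eq_bigr => u; rewrite mem_expo_below => /andP[us sul].
  have [->|gl] := eqVneq (g l (expo_sub s u)) 0; first by rewrite !mulr0.
  rewrite /quo bc // -[X in expo_lex _ X](expo_subK us); apply: expo_lexDl.
  by case: (gP l) => _ [_]; apply.
exists (quo b) => s Is; apply/eqP; rewrite subr_eq0; apply/eqP.
have [j js] : exists j, idx s = Some j.
  rewrite /idx; case: pickP => [j|nj]; first by exists j.
  have [t Tt ts] := TP s Is; have /(tnthP (in_tuple T))[j tj] := Tt.
  by have := nj j; rewrite /t_ -tj ts.
have ts : expo_le (t_ j) s by move: js; rewrite /idx; case: pickP => // l ? [<-].
have sum_at : (\sum_j quo b j * g j) s = \sum_j (quo b j * g j) s.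
  by apply: (big_morph (fun f : R => f s)).
rewrite sum_at.
have -> : \sum_l (quo b l * g l) s = tail b s +
    qcoef q (expo_sub s (t_ j)) (t_ j) * b s * g j (t_ j).
  rewrite /tail.
  (* At s only the selected generator j contributes its leading term, the other [quo] being zero
     there. *)
  have term l : (quo b l * g l) s =
      \sum_(u <- expo_below s | expo_sub s u != t_ l)
        qcoef q u (expo_sub s u) * quo b l u * g l (expo_sub s u) +
      if l == j then qcoef q (expo_sub s (t_ j)) (t_ j) * b s * g j (t_ j) else 0.
    rewrite qseries_mulE (bigID (fun u => expo_sub s u != t_ l)) /=; congr (_ + _).
    have [tls|ntls] := boolP (expo_le (t_ l) s); last first.
      rewrite big_seq_cond big_pred0; first by case: eqP ntls => // ->; rewrite ts.
      move=> u; rewrite mem_expo_below; apply/negP => /andP[us /negPn/eqP e].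
      by rewrite -(expo_subK us) e addrC expo_le_addr in ntls.
    have e u : expo_le u s -> ~~ (expo_sub s u != t_ l) -> u = expo_sub s (t_ l).
      by move=> us /negPn/eqP <-; rewrite -{1}(expo_subK us) addrC expo_addK.
    have stl : expo_sub s (expo_sub s (t_ l)) = t_ l.
      by rewrite -{1}(expo_subK tls) addrC expo_addK.
    have sle : expo_le (expo_sub s (t_ l)) s.
      by rewrite -[X in expo_le _ X](expo_subK tls) addrC expo_le_addr.
    rewrite (big_rem (expo_sub s (t_ l))) ?mem_expo_below //= stl eqxx /=.
    rewrite big_seq_cond big_pred0 ?addr0; last first.
      move=> u; apply/negP => /andP[]; rewrite rem_filter ?expo_below_uniq // mem_filter.
      by rewrite mem_expo_below => /andP[/= /eqP ne us] /(e _ us).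
    rewrite /quo addrC expo_subK // js; have [->|/eqP lj] := eqVneq l j.
      by rewrite eqxx.
    by case: eqP => [[/esym //]|_]; rewrite mulr0 mul0r.
  under eq_bigr do rewrite term.
  rewrite big_split /=; congr (_ + _).
  by rewrite -big_mkcond /= big_pred1_eq.
rewrite bE /F js mulrAC mulrCA divff ?mulr1 ?subrKC //.
by rewrite mulf_neq0 ?qcoef_neq0 //; case: (gP j) => _ [].
Qed.

Lemma qseries_remainder I f : is_left_ideal I ->
  exists2 r, I (f - r) & forall s, lead_set I s -> r s = 0.
Proof.
move=> idI; have [m [g [Ig /(_ f)[c cP]]]] := qseries_division I.
exists (f - \sum_j c j * g j) => //; rewrite subKr.
by apply: left_ideal_sum => // j; case: idI => _ _; apply.
Qed.

(** A nonzero f in I does not vanish at its own leading exponent. Hence remainders modulo a left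
    ideal are unique, and zero for its members. *)
Lemma lead_set_eq0 I f : I f -> (forall s, lead_set I s -> f s = 0) -> f = 0.
Proof.
move=> If fI; apply/eqP; apply: contrapT => /negP/is_lead_exists[s fs].
by case: (fs) => /eqP + _; apply; apply: fI; exists f.
Qed.

Lemma qseries_noetherian : left_noetherian R.
Proof.
move=> I idI; have [m [g [Ig gP]]] := qseries_division I.
exists m, g; split=> // f If; have [c cP] := gP f; exists c; apply/eqP.
rewrite -subr_eq0; apply/eqP; apply: lead_set_eq0 cP; apply: left_idealB => //.
by apply: left_ideal_sum => // j; case: idI => _ _; apply.
Qed.

End Division.

(** * Normality of monomials, torus characters, and torus-stable ideals *)

Section Monomials.
Variables (k : fieldType) (n : nat) (q : 'M[k]_n).
Hypothesis q_antisym : mult_antisym q.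
Local Notation R := (qseries q).
Implicit Types (s t u : expo n) (f g : R) (h : torus k 'I_n).

Definition expo1 (i : 'I_n) : expo n := [ffun j => nat_of_bool (j == i)].

Lemma qmon_mull t f s :
  (qmon q t * f : R) s = if expo_le t s then qcoef q t (expo_sub s t) * f (expo_sub s t) else 0.
Proof.
rewrite qseries_mulE; have [ts|nts] := ifPn.
  rewrite (bigD1_seq t) ?expo_below_uniq ?mem_expo_below //= big1 ?addr0.
    by rewrite /qmon eqxx mulr1.
  by move=> u /negPf ut; rewrite /qmon ut mulr0 mul0r.
rewrite big1_seq // => u; rewrite mem_expo_below /qmon => /andP[_ us].
by case: eqP nts => [<-|]; rewrite ?us // mulr0 mul0r.
Qed.

Lemma qmon_mullD t f s : (qmon q t * f : R) (t + s) = qcoef q t s * f s.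
Proof. by rewrite qmon_mull expo_le_addr expo_addK. Qed.

Lemma qmon_mulr t f s :
  (f * qmon q t : R) s = if expo_le t s then qcoef q (expo_sub s t) t * f (expo_sub s t) else 0.
Proof.
rewrite qseries_mulE; have [ts|nts] := ifPn.
  have le : expo_le (expo_sub s t) s by apply/expo_leP => i; rewrite ffunE leq_subr.
  have e : expo_sub s (expo_sub s t) = t by rewrite -{1}(expo_subK ts) addrC expo_addK.
  rewrite (bigD1_seq (expo_sub s t)) ?expo_below_uniq ?mem_expo_below //= e.
  rewrite big1_seq ?addr0; first by rewrite /qmon eqxx mulr1.
  move=> u /andP[ut]; rewrite mem_expo_below /qmon => us.
  case: eqP => [su|]; last by rewrite mulr0.
  by case/eqP: ut; rewrite -su -{1}(expo_subK us) addrC expo_addK.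
rewrite big1_seq // => u; rewrite mem_expo_below /qmon => /andP[_ us].
case: eqP => [e|]; last by rewrite mulr0.
by case/negP: nts; rewrite -e; apply/expo_leP => i; rewrite ffunE leq_subr.
Qed.

Lemma qmon_mulrD t f s : (f * qmon q t : R) (t + s) = qcoef q s t * f s.
Proof. by rewrite qmon_mulr expo_le_addr expo_addK. Qed.

Lemma expo_sum1 s : s = \sum_i expo1 i *+ s i.
Proof.
apply/ffunP => j; rewrite sum_ffunE (bigD1 j) //= big1 ?addr0.
  by rewrite ffunMnE ffunE eqxx -[RHS]/(_%:R) natn.
move=> i /negPf ij; rewrite ffunMnE ffunE eq_sym ij.
by elim: (s i) => // m IH; rewrite mulrS IH.
Qed.

Lemma torus_char_ext h (chi : expo n -> k) : chi 0 = 1 ->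
  (forall s t, chi (s + t) = chi s * chi t) -> (forall i, h i = chi (expo1 i)) ->
  forall s, torus_char h s = chi s.
Proof.
move=> chi0 chiD hE s; rewrite [in RHS](expo_sum1 s) (big_morph chi chiD chi0).
apply: eq_bigr => i _; rewrite hE.
by elim: (s i) => [|m IH]; rewrite ?mulr0n ?chi0 // mulrS chiD exprS IH.
Qed.

(** The scalar chi s with x^s x^t = chi s x^t x^s is multiplicative in s, so conjugation by x^t is
    the torus action of the point with coordinates chi (e_i). *)
Lemma qmon_normal (c : k) t : normal_elt (c *: qmon q t : R).
Proof.
pose chi s := qcoef q s t / qcoef q t s.
have chi_neq0 s : chi s != 0 by rewrite mulf_neq0 ?invr_eq0 ?qcoef_neq0.
pose h := Torus (fun i => chi_neq0 (expo1 i)).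
have hE : forall s, torus_char h s = chi s.
  apply: torus_char_ext => // [|s u]; rewrite /chi.
    by rewrite qcoef0l qcoef0r divr1.
  by rewrite qcoefDl qcoefDr invfM mulrACA.
exists (torus_act q h) => f; rewrite -scalerAl -scalerAr; congr (_ *: _).
apply/funext => s; have [ts|nts] := boolP (expo_le t s); last first.
  by rewrite qmon_mull qmon_mulr (negPf nts).
rewrite -(expo_subK ts) qmon_mullD qmon_mulrD /= /qseries_rescale hE.
by rewrite mulrA [X in _ = X * _]mulrC divfK ?qcoef_neq0.
Qed.

Lemma qvar_normal i : normal_elt (qvar q i).
Proof. by rewrite -[qvar q i]scale1r; apply: qmon_normal. Qed.

Lemma torus_act_qmon h t : torus_act q h (qmon q t) = torus_char h t *: qmon q t.
Proof.
apply/funext => s; rewrite qseries_scaleE /= /qseries_rescale /qmon.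
by case: eqP => [->|]; rewrite ?mulr0.
Qed.

Lemma left_idealZ (I : set R) c f : is_left_ideal I -> I f -> I (c *: f).
Proof. by move=> [_ _ IM] If; rewrite -(mul1r f) scalerAl; apply: IM. Qed.

Section InfiniteField.
Hypothesis k_infinite : infinite_set [set: k].

Lemma infinite_non_root (p : {poly k}) : p != 0 -> exists c, ~~ root p c.
Proof.
move=> p0; apply: contrapT => allroot.
have [B _ Bsize] := infinite_set_fset (size p) k_infinite.
have := @max_poly_roots _ p (finmap.enum_fset B) p0.
rewrite finmap.fset_uniq ltnNge Bsize => /(_ _ isT) H.
suff : false by []; apply: H; apply/allP => c _; apply: contrapT => /negP nr.
by apply: allroot; exists c.
Qed.

Lemma torus_char_inj s t : (forall h, torus_char h s = torus_char h t) -> s = t.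
Proof.
move=> st; apply/ffunP => i; apply/eqP; apply: contrapT => /negP nsti.
(* The factor 'X makes a non-root c nonzero, hence usable as coordinate i of a torus element whose
   other coordinates are 1. *)
pose p : {poly k} := 'X * ('X^(s i) - 'X^(t i)).
have [|c] := @infinite_non_root p.
  rewrite mulf_neq0 ?polyX_eq0 // subr_eq0; apply: contra nsti => /eqP.
  by move=> /(congr1 (fun p : {poly k} => size p)); rewrite !size_polyXn => -[->].
rewrite rootM negb_or /root !hornerE => /andP[c0].
have h_neq0 j : (if j == i then c else 1) != 0 by case: ifP; rewrite ?oner_neq0.
have := st (Torus h_neq0); rewrite /torus_char (bigD1 i) //= [RHS](bigD1 i) //= eqxx.
rewrite !big1 => [|j /negPf ->|j /negPf ->]; rewrite ?expr1n // !mulr1 => ->.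
by rewrite subrr eqxx.
Qed.

(* The reduced element of I with leading exponent s must be an eigenvector of
   the torus, hence a monomial. *)
Lemma stable_lead_qmon (I : set R) s : is_left_ideal I ->
  (forall h f, I f -> I (torus_act q h f)) -> lead_set I s -> I (qmon q s).
Proof.
move=> idI stI Is; have [r Ir r0] := qseries_remainder q_antisym (qmon q s) idI.
suff -> : qmon q s = qmon q s - r :> R by [].
apply/esym/eqP; rewrite subr_eq addrC -subr_eq subrr eq_sym; apply/eqP/funext => u.
apply: contrapT => /eqP ru.
have su : s = u; last by rewrite -su (r0 s Is) eqxx in ru.
apply: torus_char_inj => h; apply: (mulIf ru).
(* By [gE] the x^s terms cancel and g lies in I; like r it vanishes on [lead_set I], so g = 0 and h
   has the same character value at s and at any u in the support of r. *)
pose g := torus_char h s *: r - torus_act q h r.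
have gE : g = torus_act q h (qmon q s - r) - torus_char h s *: (qmon q s - r).
  by rewrite rmorphB torus_act_qmon scalerBr opprB [RHS]addrC addrA subrK.
have : g = 0.
  apply: (lead_set_eq0 (I := I)) => [|v Iv].
    by rewrite gE; apply: left_idealB => //; [apply: stI | apply: left_idealZ].
  by rewrite /g /= -[LHS]/(_ * r v - _ * r v) (r0 v Iv) !mulr0 subrr.
move=> /(congr1 (fun f : R => f u)) /eqP.
by rewrite -[X in X == _]/(_ * r u - _ * r u) subr_eq0 => /eqP.
Qed.
End InfiniteField.

(** * The ideal J_w in terms of supports, and the monomials off w *)

Section Support.
Variable w : {set 'I_n}.

Definition expo_off s : Prop := forall i, i \in w -> s i = 0%N.

Lemma expo_offD s t : expo_off s -> expo_off t -> expo_off (s + t).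
Proof. by move=> s0 t0 i iw; rewrite expo_addE s0 ?t0. Qed.

Lemma expo_off_le s t : expo_le t s -> expo_off s -> expo_off t.
Proof.
move=> /expo_leP ts s0 i iw; apply/eqP; rewrite -leqn0.
by apply: leq_trans (ts i) _; rewrite s0.
Qed.

(** For the converse, each exponent of f is assigned one i in w dividing it; grouping terms by i
    writes the infinite series f as a finite sum of products x_i g_i. *)
Lemma J_wP f : ideal_set (J_w q w) f <-> forall s, expo_off s -> f s = 0.
Proof.
split=> [Jf|f0].
  apply: (Jf [set f : R | forall s, expo_off s -> f s = 0]); split.
    split=> // [a b a0 b0 s s0|a b b0]; first by rewrite -[LHS]/(a s + b s) a0 ?b0 ?addr0.
    split=> s s0; rewrite qseries_mulE big1_seq // => t /andP[_];
      rewrite mem_expo_below => ts.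
      rewrite b0 ?mulr0 //; apply: expo_off_le s0; rewrite -[X in expo_le _ X](expo_subK ts) addrC.
      exact: expo_le_addr.
    by rewrite b0 ?mulr0 ?mul0r //; apply: expo_off_le s0.
  move=> _ [i iw <-] s s0; rewrite /qvar /qmon; case: eqP => // e.
  by have := s0 i iw; rewrite e ffunE eqxx.
have idJ := idealP (J_w q w).
pose idx s := [pick i | (i \in w) && (0 < s i)%N].
pose g i : R := fun u => if idx (u + expo1 i) == Some i
  then f (u + expo1 i) / qcoef q (expo1 i) u else 0.
have -> : f = \sum_i qvar q i * g i.
  apply/funext => s.
  have -> : (\sum_i qvar q i * g i) s = \sum_i (qvar q i * g i) s.
    by apply: (big_morph (fun f : R => f s)).
  have term i : (qvar q i * g i) s = if idx s == Some i then f s else 0.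
    rewrite qmon_mull -/(expo1 i); have [is_|nis] := ifPn.
      rewrite /g addrC expo_subK //; case: ifP => _; last by rewrite mulr0.
      by rewrite mulrC divfK ?qcoef_neq0.
    case: eqP => //; rewrite /idx; case: pickP => // j /andP[_ js] [ji]; case/negP: nis.
    by apply/expo_leP => l; rewrite ffunE; case: eqP => // ->; rewrite -ji.
  under eq_bigr do rewrite term.
  rewrite /idx; case: pickP => [i _|nw].
    by rewrite (bigD1 i) //= eqxx big1 ?addr0 // => j /negPf ji; case: eqP => // -[] /eqP; rewrite eq_sym ji.
  rewrite big1 // f0 // => i iw; apply/eqP; rewrite -leqn0 leqNgt; apply/negP => si.
  by have := nw i; rewrite iw si.
apply: left_ideal_sum (ideal_left idJ) _ => i; have [iw|niw] := boolP (i \in w).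
  by apply: (ideal_mulr _ idJ) => I [_]; apply; exists i.
have -> : g i = 0; last by rewrite mulr0; case: idJ.
apply/funext => u; rewrite /g; case: eqP => //; rewrite /idx; case: pickP => // j /andP[jw _] [ji].
by rewrite -ji jw in niw.
Qed.

Lemma J_w_congr (I : set R) f g : is_left_ideal I -> J_w q w `<=` I ->
  (forall s, expo_off s -> f s = g s) -> I f -> I g.
Proof.
move=> idI JI fg If; rewrite -(subKr f g); apply: left_idealB => //.
by apply: JI; apply/J_wP => s s0; rewrite -[LHS]/(f s - g s) fg ?subrr.
Qed.

Lemma stable_off_qmon (k_infinite : infinite_set [set: k]) (I : set R) :
  is_left_ideal I -> (forall h f, I f -> I (torus_act q h f)) -> J_w q w `<=` I ->
  I `<=` J_w q w \/ exists2 t, expo_off t & I (qmon q t).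
Proof.
move=> idI stI JI; have [IJ|nIJ] := pselect (I `<=` J_w q w); [by left | right].
have [f If [s s0 fs]] : exists2 f, I f & exists2 s, expo_off s & f s <> 0.
  apply: contrapT => nf; apply: nIJ => f If; apply/J_wP => s s0; apply: contrapT => fs.
  by apply: nf; exists f => //; exists s.
(* Truncating f to the exponents off w changes it by an element of J_w, so g stays in I and its
   leading exponent is off w. *)
pose g : R := fun s => if pselect (expo_off s) then f s else 0.
have Ig : I g by apply: J_w_congr If => // t t0; rewrite /g; case: pselect.
have [|t lt] := @is_lead_exists _ _ q g.
  apply/eqP => /(congr1 (fun g : R => g s)); rewrite /g.
  by case: pselect.
exists t; last by apply: stable_lead_qmon => //; exists g.
by case: lt => /eqP gt _; apply: contrapT => nt; apply: gt; rewrite /g; case: pselect.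
Qed.

(** Scalars are included because x^s x^t is only a scalar multiple of x^(s+t). *)
Definition off_monomials : set R :=
  [set d | exists2 c : k, c != 0 & exists2 t, expo_off t & d = c *: qmon q t].

Lemma off_monomials_closed : mul_closed off_monomials.
Proof.
split; first by exists 1; rewrite ?oner_neq0 //; exists 0; rewrite ?scale1r // => i; rewrite ffunE.
move=> _ _ [c c0 [s s0 ->]] [d d0 [t t0 ->]].
rewrite -scalerAl -scalerAr scalerA qmonM scalerA.
exists (c * d * qcoef q s t); first by rewrite !mulf_neq0 ?qcoef_neq0.
by exists (s + t) => //; apply: expo_offD.
Qed.

Lemma off_monomials_normal d : off_monomials d -> normal_elt d.
Proof. by move=> [c _ [t _ ->]]; apply: qmon_normal. Qed.

Lemma off_monomials_qvar i : i \notin w -> off_monomials (qvar q i).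
Proof.
move=> niw; exists 1; rewrite ?oner_neq0 //; exists (expo1 i); rewrite ?scale1r //.
by move=> j jw; rewrite ffunE; case: eqP niw => // <-; rewrite jw.
Qed.

Lemma prime_off_monomials (P : spec R) : Spec_w q w P ->
  forall d, off_monomials d -> ~ (P : set R) d.
Proof.
move=> wP _ [c c0 [t t0 ->]] Pct; have prP := specP P; have [idP PT _] := prP.
have Pt : (P : set R) (qmon q t).
  by rewrite -(scale1r (qmon q t)) -(mulVf c0) -scalerA; apply: left_idealZ (ideal_left idP) _.
(* Elements cancellable on the left modulo P: closed under products, they contain each x_i off w by
   normality, hence x^t. *)
pose K d := forall a, (P : set R) (d * a) -> (P : set R) a.
have K1 : K 1 by move=> a; rewrite mul1r.
have KM d e : K d -> K e -> K (d * e) by move=> Kd Ke a; rewrite -mulrA => /Kd/Ke.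
have : K (qmon q t).
  rewrite qmon_prod; apply: (big_ind K) => // i _.
  have [iw|niw] := boolP (i \in w); first by rewrite (t0 i iw) expr0.
  elim: (t i) => [|m IH]; rewrite ?expr0 // exprS; apply: KM => //.
  apply: prime_normal_mull prP (qvar_normal i) _ => /wP; exact/negP.
move=> /(_ 1); rewrite mulr1 => /(_ Pt) P1; case/eqP: PT; apply/seteqP; split=> // a _.
by rewrite -(mulr1 a); apply: ideal_mull.
Qed.

Lemma J_w_sub (P : spec R) : Spec_w q w P -> J_w q w `<=` P.
Proof.
move=> wP; apply: smallest_sub; first by case: (specP P).
by move=> _ [i iw <-]; apply/wP.
Qed.

Lemma X_wP x : X_w q w x -> exists2 d, off_monomials d & x = rquot_pi (J_w q w) d.
Proof.
move=> Xx; apply: (Xx [set x | exists2 d, off_monomials d & x = rquot_pi (J_w q w) d]).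
have [D1 DM] := off_monomials_closed; split.
  split; first by exists 1.
  by move=> _ _ [d Dd ->] [e De ->]; exists (d * e); rewrite ?rmorphM //; apply: DM.
by move=> _ [i niw <-]; exists (qvar q i) => //; apply: off_monomials_qvar; apply/negP.
Qed.

Lemma X_w_qmon t : expo_off t -> X_w q w (rquot_pi (J_w q w) (qmon q t)).
Proof.
move=> t0 M [[M1 MM] xM].
rewrite qmon_prod rmorph_prod; apply: (big_ind M) => // i _.
have [iw|niw] := boolP (i \in w); first by rewrite (t0 i iw) expr0 rmorph1.
rewrite rmorphXn; elim: (t i) => [|m IH]; rewrite ?expr0 // exprS; apply: MM => //.
by apply: xM; exists i => //; apply/negP.
Qed.

Lemma torus_char_proj h s : expo_off s ->
  torus_char (torus_ext (torus_proj w h)) s = torus_char h s.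
Proof.
move=> s0; apply: eq_bigr => i _; have [iw|niw] := boolP (i \in w).
  by rewrite (s0 i iw).
by rewrite /= /torus_ext_fun insubT.
Qed.

End Support.
End Monomials.

Arguments off_monomials {k n} q w.

(** * Torus orbits in Spec_w R and their density *)

Section TorusOrbits.
Variables (k : fieldType) (n : nat) (q : 'M[k]_n) (w : {set 'I_n}).
Local Notation R := (qseries q).
Implicit Types (h : torus k 'I_n) (P : spec R).

Definition torus1 : torus k 'I_n := Torus (fun=> oner_neq0 k).

Lemma torusV_neq0 h i : (h i)^-1 != 0.
Proof. by rewrite invr_eq0 torusP. Qed.

Definition torusV h : torus k 'I_n := Torus (torusV_neq0 h).

Definition torusM h h' : torus k 'I_n :=
  Torus (fun i => mulf_neq0 (torusP h i) (torusP h' i)).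

Lemma torus_act1 (f : R) : torus_act q torus1 f = f.
Proof.
apply/funext => s; rewrite /= /qseries_rescale /torus_char big1 ?mul1r // => i _.
by rewrite expr1n.
Qed.

Lemma torus_actM h h' (f : R) :
  torus_act q (torusM h h') f = torus_act q h (torus_act q h' f).
Proof.
apply/funext => s; rewrite /= /qseries_rescale mulrA; congr (_ * _).
by rewrite -big_split; apply: eq_bigr => i _; rewrite exprMn.
Qed.

Lemma torus_actVK h (f : R) : torus_act q h (torus_act q (torusV h) f) = f.
Proof.
rewrite -torus_actM; apply/funext => s; rewrite /= /qseries_rescale /torus_char big1 ?mul1r //.
by move=> i _; rewrite /= divff ?torusP ?expr1n.
Qed.

Lemma torus_actZ h c (f : R) : torus_act q h (c *: f) = c *: torus_act q h f.
Proof. by apply/funext => s; apply: mulrCA. Qed.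

Lemma torus_act_inj h : injective (torus_act q h).
Proof. exact: bij_inj (aut_bij (torus_act q h)). Qed.

Lemma Spec_w_act h P : Spec_w q w P -> Spec_w q w (spec_act (torus_act q h) P).
Proof.
move=> wP i; rewrite -(wP i); have [idP _ _] := specP P; have lidP := ideal_left idP.
have c0 := torus_char_neq0 h (expo1 i).
have hi : torus_act q h (qvar q i) = torus_char h (expo1 i) *: qvar q i :=
  torus_act_qmon q h (expo1 i).
split=> /= [[f Pf hf]|Pi].
  suff -> : qvar q i = torus_char h (expo1 i) *: f by apply: left_idealZ.
  by apply: (@torus_act_inj h); rewrite hi torus_actZ -hf.
exists ((torus_char h (expo1 i))^-1 *: qvar q i); first exact: left_idealZ.
by rewrite [LHS]torus_actZ hi scalerA mulVf ?scale1r.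
Qed.

Lemma Spec_w_orbits : exists2 C : set (set (spec R)),
  (forall O, C O -> exists P, O = spec_orbit (torus_act q) P) &
  Spec_w q w = \bigcup_(O in C) O.
Proof.
exists [set spec_orbit (torus_act q) P | P in Spec_w q w].
  by move=> _ [P _ <-]; exists P.
apply/seteqP; split=> [P wP|P [_ [Q wQ <-] [h _ <-]]]; last exact: Spec_w_act.
exists (spec_orbit (torus_act q) P); first by exists P.
exists torus1 => //; apply: spec_inj; apply/seteqP; split=> [_ [f Pf <-]|f Pf] /=.
  by rewrite torus_act1.
by exists f => //; apply: torus_act1.
Qed.

Definition Spec_w_pt P (wP : Spec_w q w P) : Spec_w q w :=
  exist (fun P => P \in Spec_w q w) P (mem_set wP).

Hypothesis q_antisym : mult_antisym q.
Hypothesis k_infinite : infinite_set [set: k].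

Lemma orbit_dense (P : Spec_w q w) :
  dense [set Q : Spec_w q w | spec_orbit (torus_act q) (set_val P) (set_val Q)].
Proof.
move=> O [Q OQ] [_ [I idI ->] UO]; apply: contrapT => nO.
have wP : Spec_w q w (set_val P) := set_valP P.
have wQ : Spec_w q w (set_val Q) := set_valP Q.
have [idP _ _] := specP (set_val P); have [P0 PD PM] := ideal_left idP.
have nIQ : ~ (I `<=` (set_val Q : spec R)) by move: OQ; rewrite -UO.
(* K is the intersection of the orbit of P, with h standing for its inverse. An open set missing the
   orbit is given by an ideal I inside K. *)
pose K := [set f : R | forall h, (set_val P : set R) (torus_act q h f)].
have IK : I `<=` K.
  move=> f If h.
  have IP : I `<=` spec_act (torus_act q (torusV h)) (set_val P).
    apply: contrapT => nIP; apply: nO.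
    exists (Spec_w_pt (Spec_w_act (torusV h) wP)); split; first by rewrite -UO.
    by exists (torusV h).
  by have [g Pg <-] := IP f If; rewrite torus_actVK.
have idK : is_left_ideal K.
  split=> [h|a b Ka Kb h|a b Kb h]; rewrite ?rmorph0 ?rmorphD ?rmorphM //.
    by apply: PD; [apply: Ka | apply: Kb].
  by apply: PM; apply: Kb.
have [||KJ|[t t0 /(_ torus1)]] := @stable_off_qmon _ _ q q_antisym w k_infinite K idK.
- by move=> h f Kf h'; rewrite -torus_actM; apply: Kf.
- move=> f /(J_wP q_antisym) f0 h; apply: (J_w_sub wP).
  by apply/J_wP => // s s0; rewrite /= /qseries_rescale f0 ?mulr0.
- by apply: nIQ => f /IK/KJ; apply: J_w_sub.
- rewrite torus_act1; apply: (prime_off_monomials q_antisym wP).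
  by exists 1; rewrite ?oner_neq0 //; exists t; rewrite ?scale1r.
Qed.

(** * The equivariant homeomorphism with Spec L_w, and simplicity of L_w *)

Section Localization.
Variables (L : ore_localization (X_w q w)) (act : torus_w k w -> ring_aut L).
Hypothesis act_rescale : rescaling_action act.

Let piw : {rmorphism R -> R_w q w} := rquot_pi (J_w q w).
(** L is treated as a localization of R itself at the monomials off w, with kernel J_w, so that
    primes of L and R are compared without passing through R_w. *)
Let phi : {rmorphism R -> L} := ol_map L \o piw.
Let D := off_monomials q w.

Let D_closed : mul_closed D := off_monomials_closed q_antisym w.

Let D_normal d : D d -> normal_elt d.
Proof. exact: off_monomials_normal. Qed.

Let D_unit d : D d -> exists v, v * phi d = 1 /\ phi d * v = 1.
Proof.
move=> [c c0 [t t0 ->]].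
have [v [vt tv]] := ol_unit L (X_w_qmon t0).
have phiZ (e : k) (f : R) : phi (e *: f) = phi e%:A * phi f.
  by rewrite -rmorphM -scalerAl mul1r.
have phiV : phi c^-1%:A * phi c%:A = 1 /\ phi c%:A * phi c^-1%:A = 1.
  by rewrite -!phiZ !scalerA mulVf ?mulfV // scale1r rmorph1.
exists (v * phi c^-1%:A); rewrite phiZ; split.
  by rewrite -mulrA (mulrA (phi _)) phiV.1 mul1r.
by rewrite -mulrA (mulrA (phi (qmon q t))) tv mul1r phiV.2.
Qed.

Let D_frac y : exists a d, D d /\ y * phi d = phi a.
Proof.
have [a [x [Xx ya]]] := ol_frac y; have [d Dd xd] := X_wP q_antisym Xx.
exists (rquot_repr a), d; split=> //.
by rewrite -[phi d]/(ol_map L (piw d)) -[piw d]xd ya -[in LHS](rquot_reprK a).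
Qed.

(** R_w has no torsion: multiplying by x^t, t off w, shifts the coefficients off w by t up to
    nonzero scalars. *)
Let phi_eq0 f : phi f = 0 <-> ideal_set (J_w q w) f.
Proof.
split=> [/(@ol_ker _ _ L _)[_ /(X_wP q_antisym)[d [c c0 [t t0 ->]] ->]]|Jf]; last first.
  rewrite -[phi f]/(ol_map L (piw f)).
  have -> : piw f = 0 by rewrite -(rmorph0 piw); apply/rquot_piP; rewrite subr0.
  exact: rmorph0.
rewrite -rmorphM -(rmorph0 (rquot_pi (J_w q w))) => /rquot_piP.
rewrite subr0 -scalerAr => /(J_wP q_antisym) f0; apply/J_wP => // s s0.
have := f0 _ (expo_offD t0 s0); rewrite qseries_scaleE qmon_mulrD => /eqP.
by rewrite !mulf_eq0 (negPf c0) (negPf (qcoef_neq0 q_antisym _ _)) => /eqP.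
Qed.

(** Replacing the coordinates of h in w by 1 alters the rescaled series only by an element of
    J_w. *)
Let phi_act h f : phi (torus_act q h f) = act (torus_proj w h) (phi f).
Proof.
rewrite -[RHS]/(act (torus_proj w h) (ol_map L (rquot_pi (J_w q w) f))) act_rescale.
congr (ol_map L _); apply/rquot_piP/J_wP => // s s0.
by rewrite -[LHS]/(_ * f s - _ * f s) torus_char_proj // subrr.
Qed.

Lemma right_ext_loc (P : set R) : is_ideal (loc_ext phi D P) ->
  right_ext (ol_map L) (rquot_pi (J_w q w) @` P) = loc_ext phi D P.
Proof.
move=> idE; apply/seteqP; split=> [_ [m [a [b [aP ->]]]]|y [a [d [Pa Dd ya]]]].
  apply: left_ideal_sum (ideal_left idE) _ => j; apply: ideal_mulr => //.
  have [f Pf <-] := aP j; exists f, 1; split=> //; first by case: D_closed.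
  by rewrite rmorph1 mulr1.
have [v [_ dv]] := D_unit Dd.
exists 1%N, (fun=> piw a), (fun=> v); split; first by move=> _; exists a.
by rewrite big_ord1 -[y]mulr1 -dv mulrA ya.
Qed.

Let Spec_w_ker (P : spec R) : Spec_w q w P -> phi @^-1` [set 0] `<=` P.
Proof. by move=> wP f /phi_eq0; apply: J_w_sub. Qed.

Definition localize (P : Spec_w q w) : spec L :=
  Spec (loc_ext_prime D_closed D_normal D_frac (specP (set_val P))
    (Spec_w_ker (set_valP P)) (prime_off_monomials q_antisym (set_valP P))).

Definition contract (Q : spec L) : spec R :=
  Spec (preimage_prime D_closed D_normal D_unit D_frac
    (qseries_noetherian q_antisym) (specP Q)).

Lemma contract_Spec_w Q : Spec_w q w (contract Q).
Proof.
move=> i; have [idQ QT _] := specP Q; split=> [/= Qi|iw /=].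
  apply: contrapT => /negP niw; have [v [vd _]] := D_unit (off_monomials_qvar q niw).
  case/eqP: QT; apply/seteqP; split=> // y _; rewrite -[y]mulr1 -vd.
  by do 2 apply: ideal_mull => //.
have -> : ol_map L (piw (qvar q i)) = 0 by apply/phi_eq0 => I [_]; apply; exists i.
by case: idQ.
Qed.

Definition contract_w (Q : spec L) : Spec_w q w := Spec_w_pt (contract_Spec_w Q).

Lemma localizeK : cancel localize contract_w.
Proof.
move=> P; apply: val_inj; apply: spec_inj => /=.
apply: preimage_loc_ext => //; first by case: (specP (set_val P)).
- exact: Spec_w_ker (set_valP P).
- move=> d a Dd; apply: (prime_normal_mulr (specP (set_val P)) (D_normal Dd)).
  exact: (prime_off_monomials q_antisym (set_valP P) Dd).
Qed.

Lemma contractK : cancel contract_w localize.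
Proof.
move=> Q; apply: spec_inj; apply: loc_ext_preimage => //.
by case: (specP Q).
Qed.

Lemma localize_continuous : continuous localize.
Proof.
apply/continuousP => _ [I idI ->].
exists [set P : spec R | ~ (phi @^-1` I `<=` P)].
  by exists (phi @^-1` I) => //; apply: preimage_ideal.
apply/seteqP; split=> P /= nI IP; apply: nI.
  move=> f If; have : (set_val (contract_w (localize P)) : set R) f by apply: IP.
  by rewrite localizeK.
exact: loc_ext_sub.
Qed.

Lemma contract_continuous : continuous contract_w.
Proof.
apply/continuousP => _ [_ [I idI ->] <-].
exists (ideal_gen (phi @` I)); first exact: idealP.
apply/seteqP; split=> Q /= nI IQ; apply: nI.
  by move=> f If; apply: IQ => K [_]; apply; exists f.
apply: smallest_sub; first by case: (specP Q).
by move=> _ [f If <-]; apply: IQ.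
Qed.

Lemma contract_act h Q :
  contract (spec_act (act (torus_proj w h)) Q) = spec_act (torus_act q h) (contract Q).
Proof.
apply: spec_inj; apply/seteqP; split=> /= f.
  move=> [y Qy yf]; exists (torus_act q (torusV h) f); last exact: torus_actVK.
  suff e : y = phi (torus_act q (torusV h) f) by move: Qy; rewrite e.
  apply: (bij_inj (aut_bij (act (torus_proj w h)))).
  by rewrite -phi_act torus_actVK yf.
move=> [g Qg <-]; exists (phi g) => //.
by rewrite -phi_act.
Qed.

(** Equivariance of the inverse bijection, [contract_act], transported by [localize]. *)
Lemma localize_act h (P hP : Spec_w q w) :
  set_val hP = spec_act (torus_act q h) (set_val P) ->
  localize hP = spec_act (act (torus_proj w h)) (localize P).
Proof.
move=> hPE; rewrite -[RHS]contractK; congr localize; apply: val_inj.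
rewrite [LHS]hPE -{1}(localizeK P); apply/esym.
exact: contract_act.
Qed.

(** Stability is asked only for projections of elements of H, so the same statement gives simplicity
    for H_w and for H. *)
Lemma localization_simple (M : set L) : is_ideal M ->
  (forall h, act (torus_proj w h) @` M = M) -> M = [set 0] \/ M = setT.
Proof.
move=> idM stM; have [M0 _ _] := idM.
have idI := preimage_ideal phi idM.
have [h f /= Mf|f /phi_eq0 f0|IJ|[t t0 Mt]] :=
  stable_off_qmon q_antisym (w := w) k_infinite (ideal_left idI).
- by rewrite -(stM h); exists (phi f) => //; rewrite -phi_act.
- by rewrite /= -[ol_map L _]/(phi f) f0.
- left; apply/seteqP; split=> [y My|_ -> //].
  have [a [d [Dd ya]]] := D_frac y.
  have Ma : M (phi a) by rewrite -ya; apply: ideal_mulr.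
  have : phi a = 0.
    by apply/phi_eq0; apply: IJ; apply: Ma.
  (* The unit phi d is cancelled modulo the zero ideal. *)
  rewrite -ya => yd0; apply: (unit_cancelr D_unit _ Dd) yd0.
  by split=> // [a' b' -> ->|a' b' ->]; rewrite ?addr0 ?mulr0 ?mul0r.
- right; apply/seteqP; split=> // y _.
  have Dt : D (qmon q t).
    by exists 1; rewrite ?oner_neq0 //; exists t; rewrite ?scale1r.
  have [v [vt _]] := D_unit Dt.
  by rewrite -[y]mulr1 -vt; do 2 apply: ideal_mull => //.
Qed.

End Localization.
End TorusOrbits.

Theorem mainTheorem9 (k : fieldType) (n : nat) (q : 'M[k]_n) (w : {set 'I_n})
    (k_infinite : infinite_set [set: k]) (n_gt0 : (0 < n)%N)
    (q_antisym : mult_antisym q) :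
  [/\ (* (i) *)
      exists2 C : set (set (spec (qseries q))),
        (forall O, C O -> exists P, O = spec_orbit (torus_act q) P) &
        Spec_w q w = \bigcup_(O in C) O,
      (* (ii) *)
      forall (L_w : ore_localization (X_w q w)) (act_w : torus_w k w -> ring_aut L_w),
        rescaling_action act_w -> Gamma_simple act_w,
      (* (iii) *)
      forall (L_w : ore_localization (X_w q w)) (act_w : torus_w k w -> ring_aut L_w),
        rescaling_action act_w ->
        (exists (Theta : Spec_w q w -> spec L_w) (Theta' : spec L_w -> Spec_w q w),
          [/\ forall P : Spec_w q w,
                Theta P = right_ext (ol_map L_w)
                            (rquot_pi (J_w q w) @` (set_val P : spec (qseries q)))
                :> set L_w,
              cancel Theta Theta' /\ cancel Theta' Theta,
              continuous Theta /\ continuous Theta',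
              forall (h : torus k 'I_n) (P : Spec_w q w),
                exists2 hP : Spec_w q w,
                  set_val hP = spec_act (torus_act q h) (set_val P) &
                  Theta hP = spec_act (act_w (torus_proj w h)) (Theta P)
            & forall (h : torus k 'I_n) (P : spec L_w),
                set_val (Theta' (spec_act (act_w (torus_proj w h)) P)) =
                spec_act (torus_act q h) (set_val (Theta' P))])
        /\ Gamma_simple (fun h : torus k 'I_n => act_w (torus_proj w h))
    & (* (iv) *)
      forall P : Spec_w q w,
        dense [set Q : Spec_w q w |
                spec_orbit (torus_act q) (set_val P) (set_val Q)]].
Proof.
split; first exact: Spec_w_orbits.
- move=> L act actE M idM stM.
  by apply: (localization_simple q_antisym k_infinite actE) => // h; apply: stM.
- move=> L act actE; split; last first.
    by move=> M idM stM; apply: (localization_simple q_antisym k_infinite actE).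
  exists (localize q_antisym L), (@contract_w _ _ _ _ q_antisym L); split.
  + move=> P; apply/esym/right_ext_loc => //.
    by case: (specP (localize q_antisym L P)).
  + by split; [exact: localizeK | exact: contractK].
  + by split; [exact: localize_continuous | exact: contract_continuous].
  + move=> h P; exists (Spec_w_pt (Spec_w_act h (set_valP P))) => //.
    exact: localize_act.
  + by move=> h Q; apply: contract_act.
- exact: orbit_dense.
Qed.
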